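(* Suppose that there is $\rho\in(0,1)$ with $\mathbf P(S_n>0)\to\rho$ as $n\to\infty$, and that there exist $\varepsilon_0>0$ and $a\in\mathbb N_0$ such that $\mathbf E(\log^+\Theta(a))^{\frac1\rho+\varepsilon_0}<\infty$, $\mathbf E[V(X)(\log^+\Theta(a))^{1+\varepsilon_0}]<\infty$, $\mathbf E(\log^+\Theta(a))^{\frac1{1-\rho}+\varepsilon_0}<\infty$ and $\mathbf E[U(-X)(\log^+\Theta(a))^{1+\varepsilon_0}]<\infty$. Suppose also that the random offspring generating functions are fractional-linear, i.e. with probability 1, for every $n\ge 0$, $f_n(s)=r_n+(1-r_n)\frac{q_n}{1-p_ns}$ with $p_n+q_n=1$, $p_nq_n>0$. Then for any $t\in(0,1)$ and $\lambda\in(0,\infty)$, $$\mathbf E_{\mathbf k}\left[\exp\left\{-\lambda\frac{Z_{nt}}{O_{nt,n}}\right\}\,\Big|\,T=n\right]\overset{p}{\to}\frac1{(1+\lambda)^2}\quad\text{as } n\to\infty,$$ where $\overset p\to$ denotes convergence in $\mathbf P$-probability.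
   Context: **Environment and walk.** $\mathbb N_0=\{0,1,2,\dots\}$. Let $\mathbf K$ be a random element of the space of probability measures on $\mathbb N_0$ (total variation metric), and let $\mathbf K_0,\mathbf K_1,\dots$ be i.i.d. copies of $\mathbf K$ (the random environment); $\mathbf P,\mathbf E$ are the underlying probability and expectation. Put $f_n(s)=\sum_{j\ge0}\mathbf K_n(\{j\})s^j$, $X_k=\log f_{k-1}'(1)$ (real-valued), $S_0=0$, $S_k=X_1+\dots+X_k$. $X$ denotes the logarithm of the mean of $\mathbf K$ (so $X\overset d=X_1$). Compositions: $f_{k,n}(s)=f_k(f_{k+1}(\cdots f_{n-1}(s)\cdots))$ for $0\le k\le n-1$, $f_{n,n}(s)=s$. **Process.** $(Z_n)_{n\ge0}$ is the branching process in this environment with $Z_0=1$: given the environment, $(Z_n)$ is a Markov chain and, given $Z_n=z$, $Z_{n+1}$ is a sum of $z$ i.i.d. variables with law $\mathbf K_n$. $\mathbf P_{\mathbf k},\mathbf E_{\mathbf k}$ are the probability and expectation given the environment (so $\mathbf E_{\mathbf k}[\,\cdot\,|T=n]$ is a random variable depending on the environment). $T=\min\{k:Z_k=0\}$. Everywhere $nt$ means its integer part $[nt]$. **Normalization.** $\eta_{j+1}=f_j''(1)/(f_j'(1))^2$, $b_m=\frac12\sum_{j=0}^{m-1}\eta_{j+1}e^{-S_j}$, and $$O_{m,n}=\frac{1-f_{0,n}(0)}{1-f_{m,n}(0)}\,f_{m,n}(0)\,b_m .$$ **Functions in the hypotheses.** $\gamma_0=\Gamma_0=0$, $\gamma_{j+1}=\min\{n>\gamma_j:S_n<S_{\gamma_j}\}$,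 $\Gamma_{j+1}=\min\{n>\Gamma_j:S_n>S_{\Gamma_j}\}$. $V(x)=\sum_{j\ge0}\mathbf P(S_{\gamma_j}\ge -x)$ for $x>0$, $V(0)=1$, $V(x)=0$ for $x<0$; $U(x)=1+\sum_{j\ge1}\mathbf P(S_{\Gamma_j}<x)$ for $x>0$, $U(0)=1$, $U(x)=0$ for $x<0$. $\Theta(a)=\sum_{j\ge a}j^2\mathbf K(\{j\})\big/\big(\sum_{r\ge0}r\mathbf K(\{r\})\big)^2$. *)

(* Defs.v *)
(* MathComp-Analysis; the real numbers are an arbitrary [R : realType]. *)
From HB Require Import structures.
From mathcomp Require Import all_boot all_order all_algebra.
From mathcomp Require Import all_classical all_reals all_analysis.

Set Implicit Arguments.
Unset Strict Implicit.
Unset Printing Implicit Defensive.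
Import Order.TTheory GRing.Theory Num.Theory.
Import numFieldNormedType.Exports.

Local Open Scope classical_set_scope.
Local Open Scope ring_scope.

(* Laws on N_0 are elements of [pprobability nat R], whose sigma-algebra is
   generated by the evaluations [k |-> k A]. As N_0 is countable, this is the
   Borel sigma-algebra of the total variation metric. *)

Section GeneratingFunctions.
Context {R : realType}.
Implicit Types (c : nat -> R) (k : pprobability nat R).

(* Intended for nonnegative [c] and [s]; the value is 0 if the series
   diverges. *)
Definition power_sum c (s : R) : R :=
  fine (\sum_(0 <= j <oo) (c j * s ^+ j)%:E)%E.

Definition mass k (j : nat) : R := fine (k [set j]).

Definition gf k : R -> R := power_sum (mass k).

(* f' and f'' are the termwise derivatives of the power series f; at the
   boundary point 1 they are the one-sided derivatives, that is, the first two
   factorial moments of [k]. *)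
Definition gf' k : R -> R := power_sum (pseries_diffs (mass k)).
Definition gf'' k : R -> R :=
  power_sum (pseries_diffs (pseries_diffs (mass k))).

Definition mean k : \bar R := (\sum_(0 <= j <oo) j%:R%:E * k [set j])%E.

Definition log_mean k : R := ln (fine (mean k)).

Definition Theta (a : nat) k : \bar R :=
  ((\sum_(a <= j <oo) (j%:R ^+ 2)%:E * k [set j]) / mean k ^+ 2)%E.

(* The sign of [r] is not constrained: [r < 0] is possible as long as [k] is a
   probability. *)
Definition fractional_linear k : Prop :=
  exists r p q : R, [/\ p + q = 1, 0 < p * q &
    forall s, 0 <= s <= 1 -> gf k s = r + (1 - r) * (q / (1 - p * s))].

(* P(xi_1 + ... + xi_z = y) for xi_1, ..., xi_z i.i.d. with law [k]. *)
Definition iid_sum_mass k (z y : nat) : R :=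
  \sum_(x : {ffun 'I_z -> 'I_y.+1} | (\sum_i x i == y)%N)
    \prod_(i < z) mass k (x i).

End GeneratingFunctions.

Definition log_plus {R : realType} (x : \bar R) : \bar R := maxe 0%E (lne x).

Section Environment.
Context {R : realType}.
(* A realization of the environment. *)
Implicit Types (k : nat -> pprobability nat R).

Definition walk k (n : nat) : R := \sum_(i < n) ln (gf' (k i) 1).

(* f_{m,n} = f_m o ... o f_{n-1}. *)
Definition gf_comp k (m n : nat) (s : R) : R :=
  foldr (fun i x => gf (k i) x) s (index_iota m n).

(* [eta k j] is the quantity usually written eta_{j+1}. *)
Definition eta k (j : nat) : R := gf'' (k j) 1 / gf' (k j) 1 ^+ 2.

Definition bsum k (m : nat) : R :=
  2^-1 * \sum_(j < m) eta k j * expR (- walk k j).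

Definition Onorm k (m n : nat) : R :=
  (1 - gf_comp k 0 n 0) / (1 - gf_comp k m n 0) * gf_comp k m n 0 * bsum k m.

End Environment.

(* [None] stands for the value +oo. *)
Definition first_time (p : pred nat) : option nat :=
  match pselect (exists n, p n) with
  | left h => Some (ex_minn h)
  | right _ => None
  end.

Section LadderEpochs.
Context {R : realType}.

Fixpoint ladder_epoch (e : rel R) (S : nat -> R) (j : nat) : option nat :=
  if j is i.+1 then
    obind (fun m => first_time (fun n => (m < n)%N && e (S n) (S m)))
          (ladder_epoch e S i)
  else Some 0%N.

Definition descending_epoch := ladder_epoch (fun x y => x < y).
Definition ascending_epoch := ladder_epoch (fun x y => x > y).

End LadderEpochs.

Section Annealed.
Context {R : realType} {d : measure_display} {Omega : measurableType d}.
Variable P : probability Omega R.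

Definition iid_copies {d' : measure_display} {E : measurableType d'}
    (K : Omega -> E) (Kn : nat -> Omega -> E) : Prop :=
  (forall n (A : set E), measurable A -> P (Kn n @^-1` A) = P (K @^-1` A)) /\
  (forall (I : seq nat) (A : nat -> set E), uniq I ->
    (forall i, measurable (A i)) ->
    P (\bigcap_(i in [set` I]) (Kn i @^-1` A i)) =
      (\prod_(i <- I) P (Kn i @^-1` A i))%E).

(* An infinite ladder epoch contributes nothing to the probabilities below. *)
Definition renewalV (S : Omega -> nat -> R) (x : R) : \bar R :=
  if 0 < x then
    (\sum_(0 <= j <oo)
      P [set w | exists2 n, descending_epoch (S w) j = Some n
                          & (- x <= S w n)%R])%E
  else if x == 0 then 1%E else 0%E.

Definition renewalU (S : Omega -> nat -> R) (x : R) : \bar R :=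
  if 0 < x then
    (1 + \sum_(1 <= j <oo)
      P [set w | exists2 n, ascending_epoch (S w) j = Some n
                          & (S w n < x)%R])%E
  else if x == 0 then 1%E else 0%E.

Definition cvg_in_probability (Y : nat -> Omega -> R) (l : R) : Prop :=
  forall e : R, 0 < e -> P [set w | e < `|Y n w - l|] @[n --> \oo] --> 0%E.

End Annealed.

Section Quenched.
Context {R : realType} {d : measure_display} {W : measurableType d}.
Variable mu : {measure set W -> \bar R}.

Definition branching_process (k : nat -> pprobability nat R)
    (Z : nat -> W -> nat) : Prop :=
  mu [set x | Z 0%N x = 1%N] = 1%E /\
  forall (n : nat) (z : nat -> nat),
    mu [set x | forall i, (i <= n.+1)%N -> Z i x = z i] =
    (mu [set x | forall i, (i <= n)%N -> Z i x = z i] *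
     (iid_sum_mass (k n) (z n) (z n.+1))%:E)%E.

Definition extinction_time (Z : nat -> W -> nat) (x : W) : option nat :=
  first_time (fun n => Z n x == 0%N).

Definition extinct_at (Z : nat -> W -> nat) (n : nat) : set W :=
  [set x | extinction_time Z x = Some n].

(* Conditional expectation given an event of positive probability. *)
Definition cond_expectation (Y : W -> R) (A : set W) : R :=
  (\int[mu]_(x in A) Y x) / fine (mu A).

End Quenched.

(* Main.v *)
Require Import Defs.
From HB Require Import structures.
From mathcomp Require Import all_boot all_order all_algebra.
From mathcomp Require Import all_classical all_reals all_analysis.
From mathcomp Require Import measurable_realfun ring lra zify.

Set Implicit Arguments.
Unset Strict Implicit.
Unset Printing Implicit Defensive.
Import Order.TTheory GRing.Theory Num.Theory.
Import numFieldNormedType.Exports.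

Local Open Scope classical_set_scope.
Local Open Scope ring_scope.

(** Proof idea. If [f] is fractional-linear, then [1 / (1 - f s)] is an affine
    function of [1 / (1 - s)]: it equals [1 / (f'(1) (1 - s)) + eta / 2]
    ([fractional_linear_affine]). Compositions are therefore explicit,
    [1 / (1 - f_(0,m)(s)) = e^(-S_m) / (1 - s) + b_m] ([inv_gf_comp]).

    In a fixed environment, write [u = f_(m,n)(0)] and [v = f_(m,n-1)(0)], the
    probabilities that one individual of generation [m] has no descendants at
    time [n], respectively at time [n-1]. As zero is absorbing, the transform of
    [Z_m] on [T = n] is [f_(0,m)(s u) - f_(0,m)(s v)]
    ([cond_expectation_extinct]). With the formula for [f_(0,m)] its quotient by
    the value at [s = 1] collapses ([mobius_ratio]) to
    [s / ((1 + O (1 - s)) (1 + O' (1 - s)))], where [O = O_(m,n)] and [O'] is the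
    same expression with [v] in the place of [u]. For [s = e^(-lambda / O)] this
    tends to [1 / (1 + lambda)^2] as soon as [O] tends to infinity and [O' / O]
    to 1 ([transform_error]). Both follow ([quenched_estimate]) if
    [e^(S_m) b_m] tends to infinity and if, in the environment shifted by [m]
    and with [l = n - 1 - m], both [b_l] and [e^(S_l) b_l] tend to infinity; the
    last one also has to dominate the odds [f(0) / (1 - f(0))] of the final
    generation, whose law does not depend on [n].

    By stationarity and by time reversal ([iid_reindex], [expR_walk_bsum]) the
    laws of [b_l] and of [e^(S_m) b_m] are those of partial sums
    [sum_(j < n) psi_j e^(W_j)] with a random walk [W], equal to [-S] or to [S],
    whose step [phi_j], like [psi_j], depends on the environment at time [j]
    only, so that [psi_j] is independent of [W_j]. Convergence of the whole
    series obeys a zero-one law. Since [P(S_n > 0)] tends to [rho] in (0, 1), at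
    every large time both walks are nonnegative with probability bounded away
    from zero. The terms of the series then do not tend to zero, so the series
    diverges almost surely ([perpetuity_cvg_infty]). *)

(** * Events on sequences of independent variables *)
Section SequenceSpace.
Context {d : measure_display} {E : measurableType d}.

(** Sequences carry the sigma-algebra generated by [all_boxes]; [boxes N]
    generates the events that depend on the first [N] coordinates only. *)
Definition box (N : nat) (A : nat -> set E) : set (nat -> E) :=
  [set y | forall i, (i < N)%N -> A i (y i)].

Definition boxes (N : nat) : set (set (nat -> E)) :=
  [set box N A | A in [set A | forall i, measurable (A i)]].

Definition all_boxes : set (set (nat -> E)) := \bigcup_N boxes N.

Lemma setI_closed_boxes N : setI_closed (boxes N).
Proof.
move=> _ _ [A mA <-] [B mB <-]; exists (fun i => A i `&` B i).
  by move=> i; exact: measurableI.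
by apply/seteqP; split=> [y h|y [h1 h2] i iN]; [split=> i /h []|split; auto].
Qed.

Lemma boxS N M A : (forall i, measurable (A i)) -> (N <= M)%N ->
  exists2 B, forall i, measurable (B i) & box N A = box M B.
Proof.
move=> mA NM; exists (fun i => if (i < N)%N then A i else setT).
  by move=> i; case: ifP.
apply/seteqP; split=> y h i iN; first by case: ifP => // /h.
by have := h i (leq_trans iN NM); rewrite iN.
Qed.

Lemma setI_closed_all_boxes : setI_closed all_boxes.
Proof.
move=> _ _ [N _ [A mA <-]] [M _ [B mB <-]].
have [A' mA' ->] := boxS mA (leq_maxl N M).
have [B' mB' ->] := boxS mB (leq_maxr N M).
exists (maxn N M) => //; apply: setI_closed_boxes; [exists A'|exists B'] => //.
Qed.

Lemma boxesT N : boxes N setT.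
Proof. by exists (fun=> setT) => //; apply/seteqP; split. Qed.

Lemma all_boxesT : all_boxes setT.
Proof. by exists 0%N => //; exact: boxesT. Qed.

Lemma measurable_coordinate N i : (i < N)%N ->
  measurable_fun setT (fun y : g_sigma_algebraType (boxes N) => y i).
Proof.
move=> iN _ B mB; rewrite setTI; apply: sub_sigma_algebra.
exists (fun j => if j == i then B else setT); first by move=> j; case: ifP.
apply/seteqP; split=> y /=; first by move=> /(_ _ iN); rewrite eqxx.
by move=> By j _; case: eqP => // ->.
Qed.

Lemma all_measurable_coordinate i :
  measurable_fun setT (fun y : g_sigma_algebraType all_boxes => y i).
Proof.
move=> _ B mB.
have := @measurable_coordinate i.+1 i (ltnSn i) measurableT B mB.
by rewrite !setTI; apply: sub_sigma_algebra2; exact: bigcup_sup.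
Qed.

Lemma measurable_boxes_fun d0 (T : measurableType d0) N (f : T -> nat -> E) :
  (forall i, (i < N)%N -> measurable_fun setT (f ^~ i)) ->
  measurable_fun setT (f : T -> g_sigma_algebraType (boxes N)).
Proof.
move=> mf; apply: (@measurability _ _ _ (g_sigma_algebraType (boxes N)) _ _ (boxes N)) => //.
move=> _ [_ [A mA <-] <-]; rewrite setTI.
rewrite (_ : _ @^-1` _ = \bigcap_(i in `I_N) (f ^~ i @^-1` A i)).
  apply: bigcap_measurableType => i /= iN.
  by rewrite -[X in measurable X]setTI; exact: mf.
by apply/seteqP; split => x /= h i; apply: h.
Qed.

Lemma measurable_all_boxes_fun d0 (T : measurableType d0) (f : T -> nat -> E) :
  (forall i, measurable_fun setT (f ^~ i)) ->
  measurable_fun setT (f : T -> g_sigma_algebraType all_boxes).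
Proof.
move=> mf; apply: (@measurability _ _ _ (g_sigma_algebraType all_boxes) _ _ all_boxes) => //.
move=> _ [_ [N _ [A mA <-]] <-]; rewrite setTI.
rewrite (_ : _ @^-1` _ = \bigcap_(i in `I_N) (f ^~ i @^-1` A i)).
  apply: bigcap_measurableType => i /= iN.
  by rewrite -[X in measurable X]setTI; exact: mf.
by apply/seteqP; split => x /= h i; apply: h.
Qed.

End SequenceSpace.

(** The uniqueness of finite measures on a generating pi-system, for images of
    two measures under two maps; it is stated on preimages because it is used
    for restricted and for rescaled probabilities. *)
Lemma eq_finite_measure_preimage {R : realType} {d : measure_display}
    {W : measurableType d} (T : pointedType) (G : set (set T))
    (m1 m2 : {finite_measure set W -> \bar R})
    (f g : W -> g_sigma_algebraType G) :
  measurable_fun setT f -> measurable_fun setT g ->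
  G setT -> setI_closed G ->
  (forall A, G A -> m1 (f @^-1` A) = m2 (g @^-1` A)) ->
  forall A, <<s G >> A -> m1 (f @^-1` A) = m2 (g @^-1` A).
Proof.
move=> mf mg GT GI m12.
have mf' A : measurable A -> measurable (f @^-1` A).
  by move=> mA; rewrite -[X in measurable X]setTI; exact: mf.
have mg' A : measurable A -> measurable (g @^-1` A).
  by move=> mA; rewrite -[X in measurable X]setTI; exact: mg.
have m12T : m1 setT = m2 setT by have := m12 _ GT; rewrite !preimage_setT.
have C (m : {finite_measure set W -> \bar R}) B : measurable B ->
    m (~` B) = (m setT - m B)%E.
  move=> mB; rewrite -setTD measureD//; last exact: fin_num_fun_lty.
  by rewrite setTI.
apply: (@dynkin_induction _ (g_sigma_algebraType G)) => //.
- move=> S mS h; rewrite preimage_setC preimage_setC.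
  rewrite (C m1 (f @^-1` S) (mf' S mS)) (C m2 (g @^-1` S) (mg' S mS)).
  by congr (_ - _)%E.
- move=> F mF tF /= h.
  have tI h' : trivIset setT (fun n => h' @^-1` F n : set W).
    apply/trivIsetP => i j _ _ ij; rewrite -preimage_setI.
    by move/trivIsetP : tF => /(_ i j Logic.I Logic.I ij) ->; exact: preimage_set0.
  rewrite !preimage_bigcup !measure_bigcup//.
  + by apply: eq_eseriesr => n _; exact: h.
  + by move=> n _; exact: mg'.
  + by move=> n _; exact: mf'.
Qed.

Section IID.
Context {R : realType} {d d' : measure_display} {Omega : measurableType d}
  {E : measurableType d'}.
Variables (P : probability Omega R) (K : {mfun Omega >-> E})
  (Kn : nat -> {mfun Omega >-> E}).
Hypothesis KnK : iid_copies P K Kn.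

Let env (w : Omega) (n : nat) : E := Kn n w.

Lemma iid_box (s : nat -> nat) N A : injective s ->
  (forall i, measurable (A i)) ->
  P [set w | box N A (env w \o s)] = (\prod_(i < N) P (K @^-1` A i))%E.
Proof.
move=> sI mA; pose g (j : nat) := index j [seq s i | i <- iota 0 N].
have gs i : (i < N)%N -> g (s i) = i.
  move=> iN; rewrite /g index_map// -{1}[i]add0n -(nth_iota 0 0 iN).
  by rewrite index_uniq ?size_iota ?iota_uniq.
have := KnK.2 [seq s i | i <- iota 0 N] (A \o g).
rewrite map_inj_uniq ?iota_uniq// => /(_ isT (fun i => mA _)).
rewrite (_ : \bigcap_(i in _) _ = [set w | box N A (env w \o s)]).
  move=> ->; rewrite big_map -{1}(subn0 N) -/(index_iota 0 N) big_mkord.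
  apply: eq_bigr => i _.
  by rewrite /= gs// KnK.1.
apply/seteqP; split=> w /=.
  move=> h i iN; have := h (s i); rewrite /= gs//; apply.
  by apply: map_f; rewrite mem_iota.
by move=> h _ /mapP[i + ->]; rewrite mem_iota/= => iN; rewrite gs//; exact: h.
Qed.

Lemma measurable_env_comp (s : nat -> nat) :
  measurable_fun setT
    ((fun w => env w \o s) : Omega -> g_sigma_algebraType (@all_boxes _ E)).
Proof. by apply: measurable_all_boxes_fun => i. Qed.

Lemma measurable_env_boxes (s : nat -> nat) N :
  measurable_fun setT
    ((fun w => env w \o s) : Omega -> g_sigma_algebraType (@boxes _ E N)).
Proof. by apply: measurable_boxes_fun => i. Qed.

(** Both the stationarity and the exchangeability of the environment: a time
    shift and the reversal of an initial segment are injections. On boxes this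
    is the product formula, and boxes determine a finite measure. *)
Lemma iid_reindex (s : nat -> nat) C : injective s -> <<s all_boxes >> C ->
  P [set w | C (env w \o s)] = P [set w | C (env w)].
Proof.
move=> sI mC.
apply: (@eq_finite_measure_preimage _ _ _ _ _ P P
  (fun w => env w \o s) (fun w => env w \o id)) mC.
- exact: measurable_env_comp.
- exact: measurable_env_comp.
- exact: all_boxesT.
- exact: setI_closed_all_boxes.
- move=> _ [N _ [A mA <-]].
  by rewrite [LHS](iid_box N)// [RHS](iid_box (s := id)).
Qed.

Lemma measurable_env_event s C : <<s all_boxes >> C ->
  measurable [set w | C (env w \o s)].
Proof.
by move=> mC; rewrite -[X in measurable X]setTI; exact: measurable_env_comp.
Qed.

Lemma measurable_env_past N C : <<s boxes N >> C ->
  measurable [set w | C (env w)].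
Proof.
move=> mC; rewrite -[X in measurable X]setTI.
exact: (@measurable_env_boxes id N measurableT _ mC).
Qed.

(** The past up to time [k] and the future from time [k] are independent: the
    product formula on boxes extends to one event at a time. *)
Lemma iid_past_future k A C : <<s boxes k >> A -> <<s all_boxes >> C ->
  P ([set w | A (env w)] `&` [set w | C (env w \o addn k)]) =
  (P [set w | A (env w)] * P [set w | C (env w)])%E.
Proof.
have inj_k : injective (addn k) := @addnI k.
(* Both steps compare two finite measures on boxes; the probability of the
   event that stays fixed enters as a scaling factor. *)
pose scaled (B : set Omega) : {finite_measure set Omega -> \bar R} :=
  mscale (NngNum (fine_ge0 (measure_ge0 P B))) P.
have scaledE B D : measurable B -> measurable D -> scaled B D = (P D * P B)%E.
  move=> mB mD; rewrite muleC; congr (_ * _)%E.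
  exact: fineK (fin_num_measure P B mB).
pose restr B (mB : measurable B) : {finite_measure set Omega -> \bar R} :=
  mrestr P mB.
suff boxC A' : boxes k A' -> <<s all_boxes >> C ->
    P ([set w | A' (env w)] `&` [set w | C (env w \o addn k)]) =
    (P [set w | A' (env w)] * P [set w | C (env w)])%E.
  move=> mA mC; have mC' := measurable_env_event (addn k) mC.
  have mC0 := measurable_env_event id mC.
  rewrite -scaledE//; last exact: measurable_env_past mA.
  apply: (@eq_finite_measure_preimage _ _ _ _ _ (restr _ mC') (scaled _)
    (fun w => env w) (fun w => env w)) mA.
  - exact: (measurable_env_boxes id).
  - exact: (measurable_env_boxes id).
  - exact: boxesT.
  - exact: setI_closed_boxes.
  - move=> B bB; rewrite scaledE//; first exact: boxC.
    by apply: (@measurable_env_past k); exact: sub_sigma_algebra.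
move=> bA mC; have mA := measurable_env_past (sub_sigma_algebra bA).
rewrite setIC muleC -scaledE//; last exact: (measurable_env_event id).
apply: (@eq_finite_measure_preimage _ _ _ _ _ (restr _ mA) (scaled _)
    (fun w => env w \o addn k) (fun w => env w \o id)) mC.
- exact: measurable_env_comp.
- exact: measurable_env_comp.
- exact: all_boxesT.
- exact: setI_closed_all_boxes.
- move=> _ [N _ [B mB <-]]; rewrite scaledE//; last first.
    apply: measurable_env_event; apply: sub_sigma_algebra.
    by exists N => //; exists B.
  case: bA mA => A1 mA1 <- mA.
  pose D i := if (i < k)%N then A1 i else B (i - k)%N.
  have mD i : measurable (D i) by rewrite /D; case: ifP.
  have Dl i : (i < k)%N -> D i = A1 i by rewrite /D => ->.
  have Dr i : D (k + i)%N = B i.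
    by rewrite /D ltnNge leq_addr/= addKn.
  transitivity (P [set w | box (k + N) D (env w \o id)]).
    congr (P _); apply/seteqP; split=> w /=.
      move=> [hB hA] i ikN; have [ik|ik] := ltnP i k.
        by rewrite Dl//; exact: hA.
      by rewrite -(subnKC ik) Dr; apply: hB; lia.
    move=> h; split=> i iN; first by rewrite -Dr; apply: h; lia.
    by rewrite -Dl//; apply: h; lia.
  rewrite (iid_box (s := id))// big_split_ord/=.
  rewrite -[in RHS]/(P [set w | box k A1 (env w \o id)]).
  rewrite -[in RHS]/(P [set w | box N B (env w \o id)]).
  rewrite !(iid_box (s := id))// muleC; congr (_ * _)%E.
    by apply: eq_bigr => i _; rewrite Dr.
  by apply: eq_bigr => i _; rewrite Dl.
Qed.

End IID.

(** * Divergence of exponential functionals of an oscillating random walk *)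
Section RealEvents.
Context {R : realType} {d : measure_display} {T : measurableType d}.
Implicit Type g : T -> R.

Lemma measurable_le_cst g M : measurable_fun setT g ->
  measurable [set x | g x <= M].
Proof.
move=> /(_ measurableT `]-oo, M]%classic (measurable_itv _)); rewrite setTI.
by congr measurable; apply/seteqP; split=> x /=; rewrite in_itv.
Qed.

Lemma measurable_cst_le g M : measurable_fun setT g ->
  measurable [set x | M <= g x].
Proof.
move=> /(_ measurableT `[M, +oo[%classic (measurable_itv _)); rewrite setTI.
by congr measurable; apply/seteqP; split=> x /=; rewrite in_itv/= andbT.
Qed.

Lemma measurable_cst_lt g M : measurable_fun setT g ->
  measurable [set x | M < g x].
Proof.
move=> /(_ measurableT `]M, +oo[%classic (measurable_itv _)); rewrite setTI.
by congr measurable; apply/seteqP; split=> x /=; rewrite in_itv/= andbT.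
Qed.

End RealEvents.

Section Perpetuity.
Context {R : realType} {d : measure_display} {E : measurableType d}.
Variables phi psi : E -> R.
Implicit Types y : nat -> E.

Definition psum y (n : nat) : R := \sum_(i < n) phi (y i).

(** The partial sums of the series solution of the random difference equation
    [D = psi + e^phi D'], which is [perpetuity_shift] for [k = 1]. *)
Definition perpetuity y (n : nat) : R :=
  \sum_(j < n) psi (y j) * expR (psum y j).

Lemma psum_shift y k n :
  psum y (k + n) = psum y k + psum (y \o addn k) n.
Proof. by rewrite /psum big_split_ord. Qed.

Lemma perpetuity_shift y k n :
  perpetuity y (k + n) =
  perpetuity y k + expR (psum y k) * perpetuity (y \o addn k) n.
Proof.
rewrite /perpetuity big_split_ord/=; congr (_ + _).
rewrite mulr_sumr; apply: eq_bigr => i _.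
by rewrite psum_shift expRD/= mulrCA.
Qed.

Hypotheses (mphi : measurable_fun setT phi) (mpsi : measurable_fun setT psi).

Lemma measurable_psum d0 (T : measurableType d0) n (f : T -> nat -> E) :
  (forall i, (i < n)%N -> measurable_fun setT (f ^~ i)) ->
  measurable_fun setT (fun x => psum (f x) n).
Proof.
by move=> mf; apply: measurable_sum => i; apply: measurableT_comp (mf _ _).
Qed.

Lemma measurable_perpetuity d0 (T : measurableType d0) n (f : T -> nat -> E) :
  (forall i, (i < n)%N -> measurable_fun setT (f ^~ i)) ->
  measurable_fun setT (fun x => perpetuity (f x) n).
Proof.
move=> mf; apply: measurable_sum => i; apply: measurable_funM.
  exact: measurableT_comp (mf _ _).
apply: measurableT_comp => //; apply: measurable_psum => j ji.
exact/mf/(ltn_trans ji).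
Qed.

Hypothesis psi_ge0 : forall e, 0 <= psi e.

Lemma perpetuity_ge0 y n : 0 <= perpetuity y n.
Proof. by apply: sumr_ge0 => i _; rewrite mulr_ge0// expR_ge0. Qed.

Lemma perpetuity_nd y : {homo perpetuity y : m n / (m <= n)%N >-> m <= n}.
Proof.
move=> m n mn; rewrite -(subnKC mn) perpetuity_shift lerDl.
by rewrite mulr_ge0 ?expR_ge0// perpetuity_ge0.
Qed.

Definition bounded_by (M : R) : set (nat -> E) :=
  [set y | forall n, perpetuity y n <= M].

Definition finite_perpetuity : set (nat -> E) :=
  \bigcup_(M : nat) bounded_by M%:R.

Lemma finite_perpetuityP y :
  finite_perpetuity y <-> exists M, bounded_by M y.
Proof.
split=> [[M _ h]|[M h]]; first by exists M%:R.
exists (Num.truncn M).+1 => // n; apply: (le_trans (h n)).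
by rewrite ltW// truncnS_gt.
Qed.

(** Convergence of the whole series does not depend on finitely many terms;
    this makes it an event of the future, from any time on. *)
Lemma finite_perpetuity_shift (k : nat) :
  [set y : nat -> E | finite_perpetuity (y \o addn k)] = finite_perpetuity.
Proof.
apply/seteqP; split=> y /= /finite_perpetuityP[M h]; apply/finite_perpetuityP.
  exists (perpetuity y k + expR (psum y k) * M) => n.
  apply: (le_trans (perpetuity_nd y (leq_addl k n))).
  by rewrite perpetuity_shift lerD2l ler_wpM2l// expR_ge0.
exists (expR (- psum y k) * M) => n; rewrite expRN ler_pdivlMl ?expR_gt0//.
apply: le_trans (h (k + n)%N); rewrite perpetuity_shift lerDr.
exact: perpetuity_ge0.
Qed.

Let seqE := g_sigma_algebraType (@all_boxes _ E).

Lemma measurable_bounded_by M : <<s all_boxes >> (bounded_by M).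
Proof.
rewrite (_ : bounded_by M = \bigcap_n [set y | perpetuity y n <= M]).
  apply: (@bigcapT_measurable _ seqE) => n.
  apply: (@measurable_le_cst _ _ seqE); apply: measurable_perpetuity => i _.
  exact: all_measurable_coordinate.
by apply/seteqP; split=> y h n; [move=> _|]; exact: h.
Qed.

Lemma measurable_finite_perpetuity : <<s all_boxes >> finite_perpetuity.
Proof.
apply: (@bigcupT_measurable _ seqE) => M; exact: measurable_bounded_by.
Qed.

Lemma not_finite_perpetuity y del : 0 < del ->
  (forall n, exists2 m, (n <= m)%N & del < psi (y m) * expR (psum y m)) ->
  ~ finite_perpetuity y.
Proof.
move=> d0 h [M _ yM].
have H j : exists n, j%:R * del <= perpetuity y n.
  elim: j => [|j [n IH]]; first by exists 0%N; rewrite mul0r perpetuity_ge0.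
  have [m nm dm] := h n; exists m.+1; rewrite /perpetuity big_ord_recr/=.
  rewrite -natr1 mulrDl mul1r lerD//; last exact: ltW.
  exact: le_trans IH (perpetuity_nd _ nm).
have [n] := H (Num.truncn (M%:R / del)).+1; apply/negP; rewrite -ltNge.
by apply: (le_lt_trans (yM n)); rewrite -ltr_pdivrMr// truncnS_gt.
Qed.

End Perpetuity.

Section PerpetuityDiverges.
Context {R : realType} {d d' : measure_display} {Omega : measurableType d}
  {E : measurableType d'}.
Variables (P : probability Omega R) (K : {mfun Omega >-> E})
  (Kn : nat -> {mfun Omega >-> E}).
Hypothesis KnK : iid_copies P K Kn.

Let env (w : Omega) (n : nat) : E := Kn n w.

Variables phi psi : E -> R.
Hypotheses (mphi : measurable_fun setT phi) (mpsi : measurable_fun setT psi).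
Hypothesis psi_ge0 : forall e, 0 <= psi e.

Let D w n := perpetuity phi psi (env w) n.
Let S w n := psum phi (env w) n.
Let Fin := [set w | finite_perpetuity phi psi (env w)].
Let Dle k M := [set w | D w k <= M].
Let Bnd M := [set w | bounded_by phi psi M (env w)].

Let mD n : measurable_fun setT (D ^~ n).
Proof. exact: measurable_perpetuity. Qed.

Let mS n : measurable_fun setT (S ^~ n).
Proof. exact: measurable_psum. Qed.

Let mFin : measurable Fin.
Proof.
apply: (measurable_env_event Kn id).
exact: measurable_finite_perpetuity.
Qed.

Let mBnd M : measurable (Bnd M).
Proof.
apply: (measurable_env_event Kn id).
exact: measurable_bounded_by.
Qed.

Let past_future_finite k M :
  P ((Dle k M) `&` Fin) = (P (Dle k M) * P Fin)%E.
Proof.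
rewrite [in LHS](_ : Fin = [set w | finite_perpetuity phi psi (env w \o addn k)]).
  apply: (iid_past_future KnK (k := k)
    (A := [set y | perpetuity phi psi y k <= M])).
    apply: (@measurable_le_cst _ _ (g_sigma_algebraType (boxes k))).
    by apply: measurable_perpetuity => // i ik; exact: measurable_coordinate.
  exact: measurable_finite_perpetuity.
apply/funext => w.
exact/esym/(congr1 (fun F => F (env w)) (finite_perpetuity_shift _ psi_ge0 k)).
Qed.

Let cvg_Bnd M : P (Dle k M) @[k --> \oo] --> P (Bnd M).
Proof.
rewrite (_ : Bnd M = \bigcap_k (Dle k M)); last first.
  by apply/seteqP; split=> w h n; [move=> _|]; exact: h.
apply: nonincreasing_cvg_mu => //.
- by rewrite ltey_eq fin_num_measure//; exact: measurable_le_cst.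
- by move=> n; exact: measurable_le_cst.
- by apply: bigcapT_measurable => n; exact: measurable_le_cst.
- move=> m n mn; apply/subsetPset => w /=; apply: le_trans.
  exact: perpetuity_nd.
Qed.

Let cvg_BndI M : P ((Dle k M) `&` Fin) @[k --> \oo] --> P (Bnd M).
Proof.
rewrite (_ : Bnd M = \bigcap_k ((Dle k M) `&` Fin)); last first.
  apply/seteqP; split=> w h; last by move=> n; have [] := h n Logic.I.
  by move=> n _; split; [exact: h|apply/finite_perpetuityP; exists M].
have mI k : measurable ((Dle k M) `&` Fin).
  by apply: measurableI => //; exact: measurable_le_cst.
apply: nonincreasing_cvg_mu => //.
- by rewrite ltey_eq fin_num_measure.
- exact: bigcapT_measurable.
- move=> m n mn; apply/subsetPset => w [/= h ?]; split=> //; move: h.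
  by apply: le_trans; exact: perpetuity_nd.
Qed.

Let bounded_by_indep M : P (Bnd M) = (P (Bnd M) * P Fin)%E.
Proof.
have h : (P (Dle k M) * P Fin)%E @[k --> \oo] -->
    (P (Bnd M) * P Fin)%E.
  by apply: cvgeZr; [exact: fin_num_measure|exact: cvg_Bnd].
have e : (fun k => P (Dle k M `&` Fin)) = (fun k => P (Dle k M) * P Fin)%E.
  by apply/funext => k; exact: past_future_finite.
have h1 := cvg_BndI (M := M); rewrite e in h1.
exact: (cvg_unique _ h1 h).
Qed.

(** Given [D_k <= M], the series converges with the same probability [p] as
    unconditionally, since convergence is an event of the future. As [k], and
    then [M], tends to infinity this becomes [p = p * p]. *)
Let finite_perpetuity01 : P Fin = 0%E \/ P Fin = 1%E.
Proof.
have cB : P (Bnd M%:R) @[M --> \oo] --> P Fin.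
  rewrite (_ : Fin = \bigcup_M Bnd M%:R)//.
  apply: nondecreasing_cvg_mu => //.
  move=> m n mn; apply/subsetPset => w h i; apply: le_trans (h i) _.
  by rewrite ler_nat.
have PP : P Fin = (P Fin * P Fin)%E.
  have h : (P (Bnd M%:R) * P Fin)%E @[M --> \oo] --> (P Fin * P Fin)%E.
    by apply: cvgeZr => //; exact: fin_num_measure.
  have e : (fun M => P (Bnd M%:R)) = (fun M => P (Bnd M%:R) * P Fin)%E.
    by apply/funext => M; exact: bounded_by_indep.
  by rewrite -e in h; exact: (cvg_unique _ cB h).
have pE : P Fin = (fine (P Fin))%:E by rewrite fineK// fin_num_measure.
move: PP; rewrite pE -EFinM => -[] /eqP.
rewrite -subr_eq0 -{1}[fine _]mulr1 -mulrBr mulf_eq0 => /orP[/eqP ->|].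
  by left.
by rewrite subr_eq0 => /eqP <-; right.
Qed.

Hypothesis psi_gt0 : (0 < P [set w | (0 < psi (K w))%R])%E.
Variable c : R.
Hypothesis c_gt0 : 0 < c.
Hypothesis S_ge0 : \forall n \near \oo, (c%:E <= P [set w | (0 <= S w n)%R])%E.

Let psi_gt_cst :
  exists2 del, 0 < del & (0 < P [set w | (del < psi (K w))%R])%E.
Proof.
have mK : measurable_fun setT (psi \o K) by exact: measurableT_comp.
apply: contrapT => /forall2NP h; move: psi_gt0; rewrite lt0e measure_ge0 andbT.
rewrite (_ : [set w | _] = \bigcup_n [set w | n.+1%:R^-1 < psi (K w)]).
  apply/negP; rewrite negbK -measure_le0.
  have mA n : measurable [set w | n.+1%:R^-1 < psi (K w)].
    exact: measurable_cst_lt.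
  apply: le_trans (generalized_Boole_inequality P mA _) _.
    exact: bigcupT_measurable.
  rewrite eseries0// => n _ _; apply/eqP; rewrite -measure_le0.
  by have [/negP|/negP] := h n.+1%:R^-1; rewrite ?invr_gt0 ?ltr0Sn// -leNgt.
apply/seteqP; split=> w /=; last by move=> [n _]; apply: lt_trans.
move=> h0; have [n nh] : exists n : nat, n.+1%:R^-1 < psi (K w).
  exists (Num.truncn (psi (K w))^-1); rewrite invf_plt ?posrE ?ltr0Sn//.
  exact: truncnS_gt.
by exists n.
Qed.

(** At a large time [n], with probability bounded below, the walk is
    nonnegative and the next coefficient exceeds [del]. Then so does the term
    of index [n], and by the reverse Fatou lemma this happens infinitely often
    with positive probability. *)
Let finite_perpetuity_neq1 : P Fin <> 1%E.
Proof.
move=> Fin1; have [del del0 q0] := psi_gt_cst.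
set q := P _ in q0.
pose A n := [set w | del < psi (env w n) * expR (S w n)].
have mA n : measurable (A n).
  apply: measurable_cst_lt; apply: measurable_funM.
    exact: measurableT_comp.
  exact: measurableT_comp.
have PA : \forall n \near \oo, (c%:E * q <= P (A n))%E.
  near=> n.
  have cS : (c%:E <= P [set w | (0 <= S w n)%R])%E by near: n.
  apply: (@le_trans _ _ (P [set w | (0 <= S w n)%R] * q)%E).
    by rewrite lee_wpmul2r// measure_ge0.
  have -> : q = P [set w | del < psi (Kn 0%N w)].
    apply/esym/(KnK.1 0%N (psi @^-1` [set x | del < x])).
    rewrite -[X in measurable X]setTI; apply: mpsi => //.
    exact: (@measurable_cst_lt _ _ _ id).
  have <- := iid_past_future KnK (k := n) (A := [set y | 0 <= psum phi y n])
    (C := [set y | del < psi (y 0%N)]).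
  - rewrite le_measure ?inE//.
      apply: measurableI; first exact: (measurable_cst_le 0 (mS n)).
      apply: (measurable_cst_lt del (g := fun w => psi (Kn (n + 0)%N w))).
      exact: measurableT_comp.
    move=> w [/= h1]; rewrite /A/= addn0 => h2; apply: (lt_le_trans h2).
    by rewrite ler_peMr// -expR0 ler_expR.
  - apply: (@measurable_cst_le _ _ (g_sigma_algebraType (boxes n))).
    by apply: measurable_psum => // i ik; exact: measurable_coordinate.
  - apply: (@measurable_cst_lt _ _ (g_sigma_algebraType all_boxes)).
    by apply: measurableT_comp => //; exact: all_measurable_coordinate.
have limA : (c%:E * q <= P (lim_sup_set A))%E.
  have cvgA : P (\bigcup_(k >= n) A k) @[n --> \oo] --> P (lim_sup_set A).
    apply: lim_sup_set_cvg => //; rewrite ltey_eq fin_num_measure//.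
    by apply: bigcup_measurable.
  rewrite -(cvg_lim _ cvgA)//; apply: lime_ge.
    by apply/cvg_ex; eexists; exact: cvgA.
  near=> n; apply: (@le_trans _ _ (P (A n))); first by near: n.
  rewrite le_measure ?inE//; first exact: bigcup_measurable.
  by move=> w Aw; exists n => /=.
have : (0 < P (lim_sup_set A))%E by apply: lt_le_trans limA; rewrite mule_gt0.
apply/negP; rewrite -leNgt.
have mL : measurable (lim_sup_set A).
  by apply: bigcapT_measurable => n; exact: bigcup_measurable.
have <- : P (~` Fin) = 0%E by rewrite probability_setC// Fin1 subee.
rewrite le_measure ?inE//; first exact: measurableC.
move=> w Lw; apply: (not_finite_perpetuity psi_ge0 del0) => n.
by have [m /= nm Am] := Lw n Logic.I; exists m.
Unshelve. all: by end_near.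
Qed.

(** A series whose terms do not tend to zero diverges with positive
    probability, hence almost surely by the zero-one law. *)
Lemma perpetuity_cvg_infty M :
  P [set w | perpetuity phi psi (env w) n <= M] @[n --> \oo] --> 0%E.
Proof.
have Fin0 : P Fin = 0%E by case: finite_perpetuity01.
have <- : P (Bnd M) = 0%E; last exact: cvg_Bnd.
apply: (subset_measure0 _ _ _ Fin0) => // w h.
by apply/finite_perpetuityP; exists M.
Qed.

End PerpetuityDiverges.

(** * Generating functions of fractional-linear laws *)
Section RealSeries.
Context {R : realType}.
Implicit Types (c b : nat -> R) (l : R).

Lemma cvg_series_EFin c l : series c n @[n --> \oo] --> l ->
  (\sum_(0 <= j <oo) (c j)%:E = l%:E)%E.
Proof.
move=> h; rewrite (_ : (fun n => _) = EFin \o series c).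
  by rewrite EFin_lim; [rewrite (cvg_lim _ h)|apply/cvg_ex; exists l].
by apply/funext => n; rewrite /= sumEFin.
Qed.

(** For nonnegative terms, the real value assigned by [fine] to a finite
    extended series is its sum as a real series. *)
Lemma cvg_series_fine c : (forall j, 0 <= c j) ->
  (\sum_(0 <= j <oo) (c j)%:E < +oo)%E ->
  series c n @[n --> \oo] --> fine (\sum_(0 <= j <oo) (c j)%:E)%E.
Proof.
move=> c0 coo.
have fin : (\sum_(0 <= j <oo) (c j)%:E)%E \is a fin_num.
  by rewrite ge0_fin_numE// nneseries_ge0// => n _ _; rewrite lee_fin.
have : (\sum_(0 <= j < n) (c j)%:E)%E @[n --> \oo] -->
    (\sum_(0 <= j <oo) (c j)%:E)%E.
  by apply: is_cvg_nneseries => n _ _; rewrite lee_fin.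
rewrite -{1}(fineK fin) => /fine_cvgP[_].
by under eq_fun do rewrite /= sumEFin.
Qed.

Lemma cvg_seriesD c b l m : series c n @[n --> \oo] --> l ->
  series b n @[n --> \oo] --> m ->
  series (fun j => c j + b j) n @[n --> \oo] --> l + m.
Proof.
move=> hc hb; rewrite (_ : series _ = series c \+ series b); first exact: cvgD.
by apply/funext => n; rewrite /series/= big_split.
Qed.

Lemma cvg_seriesZ c l a : series c n @[n --> \oo] --> l ->
  series (fun j => a * c j) n @[n --> \oo] --> a * l.
Proof.
move=> hc; rewrite (_ : series _ = (fun n => a * series c n)).
  exact: cvgMr.
by apply/funext => n; rewrite /series/= mulr_sumr.
Qed.

Lemma cvg_seriesS c l : series c n @[n --> \oo] --> l ->
  series (fun j => c j.+1) n @[n --> \oo] --> l - c 0%N.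
Proof.
move=> hc; rewrite (_ : series _ = (fun n => series c n.+1 - c 0%N)).
  by apply: cvgB; [move: hc; rewrite -cvg_shiftS|exact: cvg_cst].
by apply/funext => n; rewrite /series/= big_nat_recl// addrC addKr.
Qed.

Lemma cvg_expn (u : nat -> R) l i :
  u n @[n --> \oo] --> l -> u n ^+ i @[n --> \oo] --> l ^+ i.
Proof.
move=> ul; elim: i => [|i IH]; first exact: cvg_cst.
rewrite exprS (_ : (fun n => _) = u * (fun n => u n ^+ i)); first exact: cvgM.
by apply/funext => n; rewrite exprS.
Qed.

Lemma series_nd c : (forall j, 0 <= c j) ->
  {homo series c : m n / (m <= n)%N >-> m <= n}.
Proof.
move=> c0 m n mn; rewrite /series/= [leRHS](big_cat_nat (n := m))//= lerDl.
exact: sumr_ge0.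
Qed.

(** Monotone convergence for series. It lets the argument of a power series
    with nonnegative coefficients tend to 1, and a truncated power series tend
    to the full one. *)
Lemma cvg_series_interchange (a : nat -> nat -> R) b g l :
  (forall n j, 0 <= a n j <= b j) ->
  (forall j, a n j @[n --> \oo] --> b j) ->
  (forall n, series (a n) N @[N --> \oo] --> g n) ->
  g n @[n --> \oo] --> l ->
  series b N @[N --> \oo] --> l.
Proof.
move=> ab acvg sg gl.
have b0 j : 0 <= b j by have /andP[] := ab 0%N j; exact: le_trans.
have ub N : series b N <= l.
  have hN : series (a n) N @[n --> \oo] --> series b N.
    by apply: cvg_big => [|i _]; [exact: add_continuous|exact: acvg].
  apply: (ler_cvg_to hN gl); apply: nearW => n.
  rewrite -(cvg_lim _ (sg n))//; apply: nondecreasing_cvgn_le.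
    by apply: series_nd => j; have /andP[] := ab n j.
  by apply/cvg_ex; exists (g n).
have cb : cvgn (series b).
  apply: nondecreasing_is_cvgn; first exact: series_nd.
  by exists l => _ [N _ <-].
have <- : limn (series b) = l; last exact: cb.
apply/eqP; rewrite eq_le; apply/andP; split.
  by apply: limr_le => //; apply: nearW.
rewrite -(cvg_lim _ gl)//; apply: limr_le; first by apply/cvg_ex; exists l.
apply: nearW => n; rewrite -(cvg_lim _ (sg n))//; apply: ler_lim => //.
  by apply/cvg_ex; exists (g n).
by apply: nearW => N; apply: ler_sum => j _; have /andP[] := ab n j.
Qed.

End RealSeries.
Arguments cvg_seriesZ {R c l} a _.

Section GeneratingFunction.
Context {R : realType}.
Implicit Types (k : pprobability nat R) (s : R).

Lemma power_sumE (c : nat -> R) s l :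
  series (fun j => c j * s ^+ j) n @[n --> \oo] --> l -> power_sum c s = l.
Proof. by move=> /cvg_series_EFin; rewrite /power_sum => ->. Qed.

Lemma power_sum1E (c : nat -> R) l :
  series c n @[n --> \oo] --> l -> power_sum c 1 = l.
Proof.
have e : (fun j => c j * 1 ^+ j) = c.
  by apply/funext => j; rewrite expr1n mulr1.
by move=> h; apply: power_sumE; rewrite e.
Qed.

Lemma mass_ge0 k j : 0 <= mass k j.
Proof. by rewrite /mass fine_ge0. Qed.

Lemma massE k j : k [set j] = (mass k j)%:E.
Proof. by rewrite /mass fineK// fin_num_measure. Qed.

Lemma cvg_series_mass k : series (mass k) n @[n --> \oo] --> (1 : R).
Proof.
have h : (\sum_(0 <= j <oo) (mass k j)%:E = 1%:E)%E.
  rewrite -(probability_setT k).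
  have <- : \bigcup_j [set j] = [set: nat] by apply/seteqP; split=> // j; exists j.
  rewrite measure_bigcup//.
    apply/congr_lim/funext => n; apply: eq_big => j; first by rewrite in_setT.
    by move=> _; apply: esym; exact: massE.
  by apply/trivIsetP => i j _ _ /eqP ij; apply/seteqP; split=> // x [-> /ij].
rewrite -[1 in X in _ --> X]/(fine 1%:E) -h; apply: cvg_series_fine.
  exact: mass_ge0.
by rewrite h ltry.
Qed.

Arguments cvg_series_mass : clear implicits.

Lemma cvg_gf k s : 0 <= s <= 1 ->
  series (fun j => mass k j * s ^+ j) n @[n --> \oo] --> gf k s.
Proof.
move=> /andP[s0 s1]; have c0 j : 0 <= mass k j * s ^+ j.
  by rewrite mulr_ge0 ?mass_ge0// exprn_ge0.
apply: cvg_series_fine => //.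
apply: (@le_lt_trans _ _ (\sum_(0 <= j <oo) (mass k j)%:E)%E).
  apply: lee_nneseries => j _; rewrite lee_fin//.
  by rewrite ler_piMr ?mass_ge0// exprn_ile1.
by rewrite (cvg_series_EFin (cvg_series_mass k)) ltry.
Qed.

Arguments cvg_gf : clear implicits.
Arguments cvg_gf k {s}.

Lemma gf_ge0 k s : 0 <= s -> 0 <= gf k s.
Proof.
move=> s0; rewrite /gf /power_sum fine_ge0// nneseries_ge0// => j _ _.
by rewrite lee_fin mulr_ge0 ?mass_ge0// exprn_ge0.
Qed.

Lemma gf_le1 k s : 0 <= s <= 1 -> gf k s <= 1.
Proof.
move=> s01; apply: (ler_cvg_to (cvg_gf k s01) (cvg_series_mass k)).
apply: nearW => n; apply: ler_sum => j _.
by move: s01 => /andP[s0 s1]; rewrite ler_piMr ?mass_ge0// exprn_ile1.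
Qed.

Lemma gf_nd k s u : 0 <= s -> s <= u -> u <= 1 -> gf k s <= gf k u.
Proof.
move=> s0 su u1.
have s01 : 0 <= s <= 1 by rewrite s0 (le_trans su).
have u01 : 0 <= u <= 1 by rewrite (le_trans s0).
apply: (ler_cvg_to (cvg_gf k s01) (cvg_gf k u01)).
apply: nearW => n; apply: ler_sum => j _; rewrite ler_wpM2l ?mass_ge0//.
by apply: lerXn2r; rewrite ?nnegrE// (le_trans s0).
Qed.

Lemma gf'_ge0 k : 0 <= gf' k 1.
Proof.
rewrite /gf' /power_sum fine_ge0// nneseries_ge0// => j _ _.
by rewrite lee_fin expr1n mulr1 /pseries_diffs mulr_ge0 ?mass_ge0.
Qed.

Lemma gf''_ge0 k : 0 <= gf'' k 1.
Proof.
rewrite /gf'' /power_sum fine_ge0// nneseries_ge0// => j _ _.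
by rewrite lee_fin expr1n mulr1 /pseries_diffs !mulr_ge0 ?mass_ge0.
Qed.

Section FractionalLinear.
Variables (k : pprobability nat R) (r p q : R).
Hypotheses (pq1 : p + q = 1) (pq0 : 0 < p * q).
Hypothesis gfE : forall s, 0 <= s <= 1 -> gf k s = r + (1 - r) * (q / (1 - p * s)).

Let p0 : 0 < p.
Proof.
have -> : p = p ^+ 2 + p * q by rewrite expr2 -mulrDr pq1 mulr1.
by rewrite ltr_wpDl// sqr_ge0.
Qed.

Let q0 : 0 < q. Proof. by move: pq0; rewrite pmulr_rgt0. Qed.

Let qE : q = 1 - p. Proof. by rewrite -pq1 addrAC subrr add0r. Qed.

Let den_gt0 s : s <= 1 -> 0 < 1 - p * s.
Proof.
move=> s1; rewrite subr_gt0; apply: (@le_lt_trans _ _ p).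
  by rewrite ger_pMr.
by rewrite -pq1 ltrDl.
Qed.

Let natE n : n%:R = \sum_(i < n) (1 : R).
Proof. by rewrite sumr_const card_ord. Qed.

Let geom n s : \sum_(i < n) (s : R) ^+ i * (1 - s) = 1 - s ^+ n.
Proof. by rewrite -mulr_suml mulrC -[LHS]opprK -mulNr opprB -subrX1 opprB. Qed.

Let s_ n : R := 1 - harmonic n.

Let s01 n : 0 <= s_ n < 1.
Proof.
rewrite /s_ /harmonic/= subr_ge0 gtrBl invr_gt0 ltr0Sn andbT.
by rewrite invf_le1 ?ler1n// ltr0Sn.
Qed.

Let s_cvg : s_ n @[n --> \oo] --> (1 : R).
Proof.
rewrite -[X in _ --> X]subr0; apply: cvgB; first exact: cvg_cst.
exact: cvg_harmonic.
Qed.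

Let sX_cvg i : s_ n ^+ i @[n --> \oo] --> (1 : R).
Proof.
by have := cvg_expn (i := i) s_cvg; rewrite expr1n.
Qed.

Let cvg_diff1 s : 0 <= s < 1 ->
  series (fun j => mass k j.+1 * \sum_(i < j.+1) s ^+ i) n @[n --> \oo] -->
  (1 - r) * p / (1 - p * s).
Proof.
move=> /andP[s0 s1].
have s01' : 0 <= s <= 1 by rewrite s0 ltW.
have h := cvg_seriesZ (1 - s)^-1 (cvg_seriesS (cvg_seriesD (cvg_series_mass k)
  (cvg_seriesZ (-1) (cvg_gf k s01')))).
have -> : (1 - r) * p / (1 - p * s) = (1 - s)^-1 *
    (1 + -1 * gf k s - (mass k 0%N + -1 * (mass k 0%N * s ^+ 0))).
  rewrite gfE ?s0 ?ltW// expr0 qE.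
  have h1 : 1 - p * s != 0 by rewrite gt_eqF// den_gt0// ltW.
  have h2 : 1 - s != 0 by rewrite subr_eq0 gt_eqF.
  by field; rewrite h1 h2.
apply: cvg_trans h; apply: near_eq_cvg; apply: nearW => n /=.
apply: eq_bigr => j _.
have -> : mass k j.+1 + -1 * (mass k j.+1 * s ^+ j.+1) =
  mass k j.+1 * (1 - s ^+ j.+1) by ring.
have h2 : 1 - s != 0 by rewrite subr_eq0 gt_eqF.
by rewrite -geom -mulr_suml; field.
Qed.

Let cvg_series_gf' : series (pseries_diffs (mass k)) n @[n --> \oo] -->
  (1 - r) * p / q.
Proof.
apply: (@cvg_series_interchange _
  (fun n j => mass k j.+1 * \sum_(i < j.+1) s_ n ^+ i) _
  (fun n => (1 - r) * p / (1 - p * s_ n))).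
- move=> n j; have /andP[sn0 sn1] := s01 n.
  rewrite mulr_ge0 ?mass_ge0 ?sumr_ge0//= => [|i _]; last exact: exprn_ge0.
  rewrite /pseries_diffs mulrC ler_wpM2r ?mass_ge0//.
  rewrite natE.
  by apply: ler_sum => i _; rewrite exprn_ile1// ltW.
- move=> j; rewrite /pseries_diffs mulrC; apply: cvgMr.
  rewrite natE.
  by apply: cvg_big => [|i _]; [exact: add_continuous|exact: sX_cvg].
- by move=> n; exact: cvg_diff1.
- rewrite -[q in X in _ --> X](_ : 1 - p * 1 = q); last by rewrite mulr1 qE.
  apply: cvgMr; apply: cvgV; first by rewrite mulr1 -qE gt_eqF.
  by apply: cvgB; [exact: cvg_cst|apply: cvgMr].
Qed.

(** The mean is the limit, as [s] tends to 1, of the difference quotient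
    [(1 - f s) / (1 - s)], which is a series with nonnegative coefficients. *)
Lemma fractional_linear_gf' : gf' k 1 = (1 - r) * p / q.
Proof. exact: power_sum1E cvg_series_gf'. Qed.

Let geom2 j s : \sum_(i < j.+2) (1 - s ^+ i) =
  (1 - s) * \sum_(i < j.+2) \sum_(l < i) (s : R) ^+ l.
Proof.
by rewrite mulr_sumr; apply: eq_bigr => i _; rewrite -geom -mulr_suml mulrC.
Qed.

Let sum_id2 j : 2 * \sum_(i < j.+2) (i%:R : R) = j.+1%:R * j.+2%:R.
Proof.
elim: j => [|j IH]; first by rewrite !big_ord_recr big_ord0/=; ring.
by rewrite big_ord_recr/= mulrDr IH -!natrM -natrD; congr _%:R; lia.
Qed.

Let cvg_diff2 s : 0 <= s < 1 ->
  series (fun j => mass k j.+2 * (2 * \sum_(i < j.+2) \sum_(l < i) s ^+ l)) n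
    @[n --> \oo] --> 2 * (1 - r) * p ^+ 2 / (q * (1 - p * s)).
Proof.
move=> s01s; have /andP[s0 s1] := s01s.
have h := cvg_seriesZ (2 / (1 - s)) (cvg_seriesS (cvg_seriesD cvg_series_gf'
  (cvg_seriesZ (-1) (cvg_diff1 s01s)))).
have -> : 2 * (1 - r) * p ^+ 2 / (q * (1 - p * s)) = 2 / (1 - s) *
    ((1 - r) * p / q + -1 * ((1 - r) * p / (1 - p * s)) -
    (pseries_diffs (mass k) 0%N + -1 * (mass k 1%N * \sum_(i < 1) s ^+ i))).
  rewrite /pseries_diffs big_ord_recr big_ord0/= qE.
  have h1 : 1 - p * s != 0 by rewrite gt_eqF// den_gt0// ltW.
  have h2 : 1 - s != 0 by rewrite subr_eq0 gt_eqF.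
  have h3 : 1 - p != 0 by rewrite -qE gt_eqF.
  by field; rewrite h1 h2 h3.
apply: cvg_trans h; apply: near_eq_cvg; apply: nearW => n /=.
apply: eq_bigr => j _; rewrite /pseries_diffs.
have h2 : 1 - s != 0 by rewrite subr_eq0 gt_eqF.
have -> : j.+2%:R * mass k j.+2 +
    -1 * (mass k j.+2 * \sum_(i < j.+2) s ^+ i) =
  mass k j.+2 * \sum_(i < j.+2) (1 - s ^+ i).
  by rewrite sumrB sumr_const card_ord; ring.
by rewrite geom2; field.
Qed.

Let diffs2E j : pseries_diffs (pseries_diffs (mass k)) j =
  mass k j.+2 * (2 * \sum_(i < j.+2) i%:R).
Proof. by rewrite sum_id2 /pseries_diffs mulrA mulrC. Qed.

(** The same limit is taken once more, in
    [(f' 1 - (1 - f s) / (1 - s)) / (1 - s)], which tends to [f'' 1 / 2]. *)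
Lemma fractional_linear_gf'' : gf'' k 1 = 2 * (1 - r) * p ^+ 2 / q ^+ 2.
Proof.
apply: power_sum1E.
apply: (@cvg_series_interchange _ (fun n j => mass k j.+2 *
    (2 * \sum_(i < j.+2) \sum_(l < i) s_ n ^+ l)) _
  (fun n => 2 * (1 - r) * p ^+ 2 / (q * (1 - p * s_ n)))).
- move=> n j; have /andP[sn0 sn1] := s01 n.
  rewrite mulr_ge0 ?mass_ge0 ?mulr_ge0 ?sumr_ge0//= => [|i _]; last first.
    by apply: sumr_ge0 => l _; exact: exprn_ge0.
  rewrite diffs2E ler_wpM2l ?mass_ge0// ler_wpM2l//; apply: ler_sum => i _.
  rewrite natE.
  by apply: ler_sum => l _; rewrite exprn_ile1// ltW.
- move=> j; rewrite diffs2E; apply: cvgMr.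
  apply: cvgMr; apply: cvg_big => [|i _]; first exact: add_continuous.
  rewrite natE.
  by apply: cvg_big => [|l _]; [exact: add_continuous|exact: sX_cvg].
- by move=> n; exact: cvg_diff2.
- rewrite [q ^+ 2]expr2 -[X in _ / (q * X)](_ : 1 - p * 1 = q); last by rewrite mulr1 qE.
  apply: cvgMr; apply: cvgV; first by rewrite mulf_neq0 ?mulr1 -?qE ?gt_eqF.
  by apply: cvgMr; apply: cvgB; [exact: cvg_cst|apply: cvgMr].
Qed.

End FractionalLinear.

End GeneratingFunction.

(** * Compositions of fractional-linear functions *)
Section FractionalLinearStep.
Context {R : realType}.
Implicit Types (e : pprobability nat R) (s : R).

Definition half_eta e : R := 2^-1 * (gf'' e 1 / gf' e 1 ^+ 2).

Lemma half_eta_ge0 e : 0 <= half_eta e.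
Proof. by rewrite mulr_ge0// divr_ge0 ?gf''_ge0 ?exprn_ge0 ?gf'_ge0. Qed.

(** Both sides are the series of [j * e{j}], from 1 and from 0 on. *)
Lemma gf'_mean e : gf' e 1 = fine (mean e).
Proof.
rewrite /gf' /power_sum /mean; congr fine.
rewrite [RHS]nneseries_recl//; last by move=> j _; rewrite mule_ge0// lee_fin.
rewrite mul0e add0e -(nneseries_addn (f := fun j => (j%:R%:E * e [set j])%E)).
  apply: eq_eseriesr => j _.
  by rewrite expr1n mulr1 /pseries_diffs addn1 massE -EFinM.
by move=> j; rewrite mule_ge0// lee_fin.
Qed.

(** Here [f' 1 = (1 - r) p / q] and [eta / 2 = 1 / (1 - r)], while
    [1 - f s = (1 - r) p (1 - s) / (1 - p s)] and
    [1 - p s = q + p (1 - s)]. *)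
Lemma fractional_linear_affine e : fractional_linear e -> 0 < gf' e 1 ->
  0 < half_eta e /\ forall s, 0 <= s < 1 ->
  gf e s < 1 /\ (1 - gf e s)^-1 = (gf' e 1)^-1 / (1 - s) + half_eta e.
Proof.
move=> [r [p [q [pq1 pq0 gfE]]]]; have f1 := fractional_linear_gf' pq1 pq0 gfE.
have f2 := fractional_linear_gf'' pq1 pq0 gfE.
have p0 : 0 < p.
  have -> : p = p ^+ 2 + p * q by rewrite expr2 -mulrDr pq1 mulr1.
  by rewrite ltr_wpDl// sqr_ge0.
have q0 : 0 < q by move: pq0; rewrite pmulr_rgt0.
rewrite /half_eta f1 f2 ltr_pdivlMr// mul0r pmulr_lgt0// => r0.
have r1 : 1 - r != 0 by rewrite gt_eqF.
have -> : 2^-1 * (2 * (1 - r) * p ^+ 2 / q ^+ 2 / ((1 - r) * p / q) ^+ 2) =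
    (1 - r)^-1 by field; rewrite r1 !gt_eqF.
split; first by rewrite invr_gt0.
move=> s /andP[s0 s1].
have d0 : 0 < 1 - p * s.
  rewrite subr_gt0; apply: (@le_lt_trans _ _ p); first by rewrite ger_pMr// ltW.
  by rewrite -pq1 ltrDl.
have qE : q = 1 - p by rewrite -pq1 addrAC subrr add0r.
have e1 : 1 - gf e s = (1 - r) * p * (1 - s) / (1 - p * s).
  by rewrite gfE ?s0 ?ltW// qE; field; rewrite gt_eqF.
have e0 : 0 < 1 - gf e s by rewrite e1 divr_gt0 ?mulr_gt0// subr_gt0.
split; first by rewrite -subr_gt0.
rewrite e1 qE; field; rewrite r1 -qE !gt_eqF//.
by rewrite subr_gt0.
Qed.

End FractionalLinearStep.

Section Composition.
Context {R : realType}.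
Implicit Types (k : nat -> pprobability nat R) (s : R).

Lemma gf_compS k n s : gf_comp k 0 n.+1 s = gf_comp k 0 n (gf (k n) s).
Proof. by rewrite /gf_comp /index_iota !subn0 -addn1 iotaD foldr_cat. Qed.

Lemma gf_comp_cat k m n s : (m <= n)%N ->
  gf_comp k 0 n s = gf_comp k 0 m (gf_comp k m n s).
Proof.
by move=> mn; rewrite /gf_comp /index_iota !subn0 -{1}(subnKC mn) iotaD foldr_cat.
Qed.

Lemma gf_comp_shift k m n s : gf_comp k m n s = gf_comp (k \o addn m) 0 (n - m) s.
Proof.
rewrite /gf_comp /index_iota subn0 -[in LHS](addn0 m) iotaDl foldr_map.
by rewrite addn0.
Qed.

Lemma walkS k n : walk k n.+1 = walk k n + ln (gf' (k n) 1).
Proof. by rewrite /walk big_ord_recr. Qed.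

Lemma bsumE k n : bsum k n = \sum_(j < n) half_eta (k j) * expR (- walk k j).
Proof.
rewrite /bsum mulr_sumr; apply: eq_bigr => j _.
by rewrite /half_eta /eta mulrA.
Qed.

Lemma bsumS k n : bsum k n.+1 = bsum k n + half_eta (k n) * expR (- walk k n).
Proof. by rewrite !bsumE big_ord_recr. Qed.

Lemma walk_psum k n : walk k n = psum (fun e => ln (gf' e 1)) k n.
Proof. by []. Qed.

Lemma psumN (phi : pprobability nat R -> R) k n :
  psum (fun e => - phi e) k n = - psum phi k n.
Proof. by rewrite /psum sumrN. Qed.

Lemma bsum_perpetuity k n :
  bsum k n = perpetuity (fun e => - ln (gf' e 1)) half_eta k n.
Proof.
by rewrite bsumE; apply: eq_bigr => j _; rewrite psumN walk_psum.
Qed.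

Definition rev_first (n i : nat) : nat := if (i < n)%N then (n.-1 - i)%N else i.

Lemma rev_first_inj n : injective (rev_first n).
Proof. by rewrite /rev_first => i j; do 2!case: ifP; lia. Qed.

Lemma eq_perpetuity (phi psi : pprobability nat R -> R) k k' n :
  (forall i, (i < n)%N -> k i = k' i) ->
  perpetuity phi psi k n = perpetuity phi psi k' n.
Proof.
move=> kk'; apply: eq_bigr => j _; rewrite kk'//; congr (_ * expR _).
by apply: eq_bigr => i _; rewrite kk'// (ltn_trans _ (ltn_ord j)).
Qed.

(** Seen from its end point, [b_n] is a perpetuity of the reversed environment.
    The factor [e^phi] in the coefficients appears because [S_n - S_j] contains
    the step of index [j] itself. *)
Lemma expR_walk_bsum k n : expR (walk k n) * bsum k n =
  perpetuity (fun e => ln (gf' e 1))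
    (fun e => half_eta e * expR (ln (gf' e 1))) (k \o rev_first n) n.
Proof.
elim: n => [|n IH]; first by rewrite bsumE /perpetuity !big_ord0 mulr0.
rewrite -[n.+1 in RHS]add1n perpetuity_shift add1n.
rewrite (@eq_perpetuity _ _ _ (k \o rev_first n) n); last first.
  by move=> i ni; rewrite /= /rev_first ni add1n ltnS ni; congr k; lia.
rewrite -IH /perpetuity /psum !big_ord_recr !big_ord0/= /rev_first/= !subn0.
rewrite expR0 mulr1 !add0r walkS bsumS expRD expRN.
by field; rewrite gt_eqF// expR_gt0.
Qed.

End Composition.

Section RegularEnvironment.
Context {R : realType}.
Variable k : nat -> pprobability nat R.
Hypothesis FLk : forall i, fractional_linear (k i).
Hypothesis meank : forall i, 0 < gf' (k i) 1.

Lemma gf_comp_bounds n s : 0 <= s < 1 -> 0 <= gf_comp k 0 n s < 1.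
Proof.
elim: n s => [//|n IH] s /andP[s0 s1]; rewrite gf_compS; apply: IH.
rewrite gf_ge0//=; have [_ /(_ s)] := fractional_linear_affine (FLk n) (meank n).
by rewrite s0 s1 => -[].
Qed.

(** The composition of the affine maps of [fractional_linear_affine] is
    computed by the walk and by [b_n]. *)
Lemma inv_gf_comp n s : 0 <= s < 1 ->
  (1 - gf_comp k 0 n s)^-1 = expR (- walk k n) / (1 - s) + bsum k n.
Proof.
elim: n s => [|n IH] s s01.
  by rewrite /gf_comp/= /walk bsumE !big_ord0 oppr0 expR0 addr0 mul1r.
have /andP[s0 s1] := s01.
have [_ /(_ s s01)[g1 gE]] := fractional_linear_affine (FLk n) (meank n).
rewrite gf_compS IH ?gf_ge0// gE walkS bsumS opprD expRD expRN (expRN (ln _)).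
rewrite lnK ?posrE//; ring.
Qed.

Lemma bsum_gt0 n : (0 < n)%N -> 0 < bsum k n.
Proof.
case: n => // n _; rewrite bsumS ltr_wpDl//.
  rewrite bsumE; apply: sumr_ge0 => j _.
  by rewrite mulr_ge0 ?half_eta_ge0 ?expR_ge0.
rewrite mulr_gt0 ?expR_gt0//.
by have [] := fractional_linear_affine (FLk n) (meank n).
Qed.

End RegularEnvironment.

Section RegularIncrement.
Context {R : realType}.
Variable k : nat -> pprobability nat R.
Hypothesis FLk : forall i, fractional_linear (k i).
Hypothesis meank : forall i, 0 < gf' (k i) 1.

Definition extinction_odds (e : pprobability nat R) : R := gf e 0 / (1 - gf e 0).

Lemma gf_comp_nd n s u : 0 <= s -> s <= u -> u < 1 ->
  gf_comp k 0 n s <= gf_comp k 0 n u.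
Proof.
elim: n s u => [//|n IH] s u s0 su u1; rewrite !gf_compS; apply: IH.
- exact: gf_ge0.
- by apply: gf_nd => //; exact: ltW.
- have [_ /(_ u)] := fractional_linear_affine (FLk n) (meank n).
  by rewrite (le_trans s0)// u1 => -[].
Qed.

Lemma gf_comp0_nd n : gf_comp k 0 n 0 <= gf_comp k 0 n.+1 0.
Proof.
rewrite gf_compS; apply: gf_comp_nd; rewrite ?gf_ge0//.
by have [_ /(_ 0)[|//]] := fractional_linear_affine (FLk n) (meank n); rewrite lexx/=.
Qed.

Lemma survival_le n : (0 < n)%N -> 1 - gf_comp k 0 n 0 <= (bsum k n)^-1.
Proof.
move=> n0; have z01 : 0 <= (0 : R) < 1 by rewrite lexx/=.
have := inv_gf_comp FLk meank n z01; have b0 := bsum_gt0 FLk meank n0.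
have /andP[_ g1] := gf_comp_bounds FLk meank n z01.
move=> e; rewrite -[leLHS]invrK lef_pV2 ?posrE ?invr_gt0 ?subr_gt0//.
by rewrite e lerDr subr0 divr1 expR_ge0.
Qed.

(** In the coordinate [1 / (1 - s)] one more generation adds
    [e^(-S_n) f_n(0) / (1 - f_n(0))] to a quantity that is at least [b_n]. *)
Lemma survival_increment n : (0 < n)%N ->
  (gf_comp k 0 n.+1 0 - gf_comp k 0 n 0) / (1 - gf_comp k 0 n 0) <=
  extinction_odds (k n) / (expR (walk k n) * bsum k n).
Proof.
move=> n0; have z01 : 0 <= (0 : R) < 1 by rewrite lexx/=.
have b0 := bsum_gt0 FLk meank n0.
have /andP[_ g1] := gf_comp_bounds FLk meank n z01.
have /andP[_ g2] := gf_comp_bounds FLk meank n.+1 z01.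
have [_ /(_ 0 z01)[h1 _]] := fractional_linear_affine (FLk n) (meank n).
have h0 := gf_ge0 (k n) (lexx 0).
have e1 := inv_gf_comp FLk meank n z01.
have e2 : (1 - gf_comp k 0 n.+1 0)^-1 =
    expR (- walk k n) / (1 - gf (k n) 0) + bsum k n.
  by rewrite gf_compS inv_gf_comp ?h0.
rewrite subr0 divr1 in e1; rewrite /extinction_odds.
move: g1 g2 e1 e2 b0 h0 h1; rewrite expRN.
move: (gf_comp k 0 n.+1 0) (gf_comp k 0 n 0) (expR _) (expR_gt0 (walk k n)).
move=> u u' E E0; move: (bsum k n) (gf (k n) 0) => b x u'1 u1 e1 e2 b0 x0 x1.
have -> : u = 1 - (E^-1 / (1 - x) + b)^-1 by rewrite -e2 invrK; ring.
have -> : u' = 1 - (E^-1 + b)^-1 by rewrite -e1 invrK; ring.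
have x2 : 0 < 1 - x by rewrite subr_gt0.
have Eb : 0 < 1 + E * b by rewrite addr_gt0// mulr_gt0.
have Ebx : 0 < 1 + E * b * (1 - x) by rewrite addr_gt0// !mulr_gt0.
have -> : (1 - (E^-1 / (1 - x) + b)^-1 - (1 - (E^-1 + b)^-1)) /
    (1 - (1 - (E^-1 + b)^-1)) = x / (1 + E * b * (1 - x)).
  field; rewrite !gt_eqF//; nra.
have -> : x / (1 - x) / (E * b) = x / (E * b * (1 - x)).
  by field; rewrite !gt_eqF.
by rewrite ler_wpM2l// lef_pV2 ?posrE ?mulr_gt0// lerDr.
Qed.

End RegularIncrement.

Section TransformEstimate.
Context {R : realType}.
Implicit Types A b u s : R.

(** The function [f] with [1 / (1 - f x) = A / (1 - x) + b]: by [inv_gf_comp]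
    these are the generating functions of the population sizes. *)
Definition mobius (A b x : R) : R := 1 - (A / (1 - x) + b)^-1.

(** A difference of values of [f] factors, and [x |-> 1 - f x] is a ratio of
    affine functions; the quotients [x b / (A + b (1 - x))] that result are the
    normalization [O] for [x = u] and its analogue for [x = v]. *)
Lemma mobius_ratio A b u v s : 0 < A -> 0 < b -> 0 <= v -> v < u -> u < 1 ->
  0 < s -> s <= 1 ->
  (mobius A b (s * u) - mobius A b (s * v)) / (mobius A b u - mobius A b v) =
  s / ((1 + u * b / (A + b * (1 - u)) * (1 - s)) *
       (1 + v * b / (A + b * (1 - v)) * (1 - s))).
Proof.
move=> A0 b0 v0 vu u1 s0 s1; rewrite /mobius.
have v1 := lt_trans vu u1; have u0 := le_lt_trans v0 vu.
have su : s * u < 1 by nra.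
have sv : s * v < 1 by nra.
have dif x y : x < 1 -> y < 1 ->
    1 - (A / (1 - x) + b)^-1 - (1 - (A / (1 - y) + b)^-1) =
    (x - y) * A / ((A + b * (1 - x)) * (A + b * (1 - y))).
  move=> x1 y1; have hx : 0 < A + b * (1 - x) by nra.
  have hy : 0 < A + b * (1 - y) by nra.
  by field; rewrite !gt_eqF ?subr_gt0.
rewrite !dif//.
have hu : 0 < A + b * (1 - u) by nra.
have hv : 0 < A + b * (1 - v) by nra.
have hsu : 0 < A + b * (1 - s * u) by nra.
have hsv : 0 < A + b * (1 - s * v) by nra.
have uv : u - v != 0 by rewrite subr_eq0 gt_eqF.
have eu x : 0 < A + b * (1 - x) ->
    1 + x * b / (A + b * (1 - x)) * (1 - s) =
    (A + b * (1 - s * x)) / (A + b * (1 - x)).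
  by move=> h; field; rewrite gt_eqF.
by rewrite !eu//; field; rewrite uv !gt_eqF.
Qed.

(** The limit [1 / (1 + lambda)^2] of the conditional transform, when [y = 1/O]
    tends to 0 and the ratio [rho] of the two normalizations tends to 1. All
    three factors are in [[0, 1]], and [(1 - e^(- lambda y)) / y] lies between
    [lambda - lambda^2 y] and [lambda]. *)
Lemma transform_error (lambda y rho : R) :
  0 < lambda -> 0 < y -> 0 <= rho -> rho <= 1 ->
  `|expR (- (lambda * y)) /
      ((1 + y^-1 * (1 - expR (- (lambda * y)))) *
       (1 + rho * y^-1 * (1 - expR (- (lambda * y))))) - (1 + lambda) ^- 2|
  <= (lambda + 2 * lambda ^+ 2) * y + lambda * (1 - rho).
Proof.
move=> l0 y0 r0 r1; set s := expR _.
have s0 : 0 < s by exact: expR_gt0.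
have ly : 0 < lambda * y by exact: mulr_gt0.
have s_lt : s < 1 by rewrite /s -expR0 ltr_expR oppr_lt0.
have s_ge : 1 - lambda * y <= s by exact: expR_ge1Dx.
pose q := y^-1 * (1 - s).
have q_le : q <= lambda by rewrite /q mulrC ler_pdivrMr//; lra.
(* [exp(z) >= 1 + z] at [z = lambda * y] *)
have q_ge : lambda - lambda ^+ 2 * y <= q.
  rewrite /q [leRHS]mulrC ler_pdivlMr//.
  have : 1 + lambda * y <= s^-1 by rewrite /s expRN invrK expR_ge1Dx.
  rewrite -(ler_pM2l s0) mulfV ?gt_eqF// => h; nra.
have q0 : 0 < q by rewrite mulr_gt0 ?invr_gt0 ?subr_gt0.
have -> : rho * y^-1 * (1 - s) = rho * q by rewrite mulrA.
rewrite -/q.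
have rq0 : 0 <= rho * q by rewrite mulr_ge0// ltW.
pose a := (1 + q)^-1; pose b := (1 + rho * q)^-1; pose c := (1 + lambda)^-1.
have -> : s / ((1 + q) * (1 + rho * q)) - (1 + lambda) ^- 2 =
    (s - 1) * (a * b) + (a - c) * b + c * (b - c).
  by rewrite /a /b /c; field; rewrite !gt_eqF//; nra.
have inv01 (x : R) : 0 <= x -> 0 <= (1 + x)^-1 <= 1.
  by move=> x0; rewrite invr_ge0 invf_le1 ?lerDl ?addr_ge0 ?ltr_pwDl.
have /andP[a0 a1] : 0 <= a <= 1 by apply: inv01; exact: ltW.
have /andP[b0 b1] : 0 <= b <= 1 by exact: inv01.
have /andP[c0 c1] : 0 <= c <= 1 by apply: inv01; exact: ltW.
have inv_lip (x z : R) : 0 <= x -> 0 <= z ->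
    `|(1 + x)^-1 - (1 + z)^-1| <= `|x - z|.
  move=> x0 z0; have -> : (1 + x)^-1 - (1 + z)^-1 =
      (z - x) * ((1 + x)^-1 * (1 + z)^-1) by field; rewrite !gt_eqF; lra.
  have /andP[? ?] := inv01 _ x0; have /andP[? ?] := inv01 _ z0.
  rewrite normrM distrC ler_piMr// ger0_norm ?mulr_ge0//.
  by rewrite mulr_ile1.
have ac : `|a - c| <= lambda ^+ 2 * y.
  apply: (le_trans (inv_lip _ _ (ltW q0) (ltW l0))).
  by rewrite ler0_norm; lra.
have bc : `|b - c| <= lambda ^+ 2 * y + lambda * (1 - rho).
  apply: (le_trans (inv_lip _ _ rq0 (ltW l0))).
  rewrite ler0_norm; nra.
apply: le_trans (ler_normD _ _) _.
apply: le_trans (lerD (ler_normD _ _) (lexx _)) _.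
have h1 : `|(s - 1) * (a * b)| <= lambda * y.
  rewrite normrM (ger0_norm (mulr_ge0 a0 b0)) ler0_norm; last lra.
  by apply: (@le_trans _ _ (- (s - 1))); [rewrite ler_piMr ?mulr_ile1//|]; lra.
have h2 : `|(a - c) * b| <= `|a - c| by rewrite normrM (ger0_norm b0) ler_piMr.
have h3 : `|c * (b - c)| <= `|b - c| by rewrite normrM (ger0_norm c0) ler_piMl.
move: h1 h2 h3 ac bc; lra.
Qed.

End TransformEstimate.

(** * Joint transforms of the process in a fixed environment *)
Section IIDSum.
Context {R : realType}.
Variable k : pprobability nat R.

Let trunc N : {poly R} := \poly_(j < N) mass k j.

Let coef_pow_mono (p q : {poly R}) y i :
  (forall j, 0 <= p`_j <= q`_j) -> 0 <= (p ^+ y)`_i <= (q ^+ y)`_i.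
Proof.
move=> pq; elim: y i => [|y IH] i.
  by rewrite !expr0 coef1 lexx andbT ler0n.
rewrite !exprS !coefM sumr_ge0/= => [|j _].
  apply: ler_sum => j _; have /andP[? ?] := IH (i - j)%N.
  by have /andP[? ?] := pq j; exact: ler_pM.
by have /andP[? _] := IH (i - j)%N; have /andP[? _] := pq j; exact: mulr_ge0.
Qed.

Let coef_pow_eq (p q : {poly R}) y m i : (i <= m)%N ->
  (forall j, (j <= m)%N -> p`_j = q`_j) -> (p ^+ y)`_i = (q ^+ y)`_i.
Proof.
move=> im pq; elim: y i im => [//|y IH] i im; rewrite !exprS !coefM.
apply: eq_bigr => j _; rewrite pq; last by have := ltn_ord j; lia.
by rewrite IH//; lia.
Qed.

(** The convolution powers of the law are read off polynomials, since the
    masses beyond [z] do not contribute to the coefficient of degree [z]. *)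
Let iid_sum_massE y z : iid_sum_mass k y z = (trunc z.+1 ^+ y)`_z.
Proof.
have -> : trunc z.+1 = \sum_(j < z.+1) (mass k j)%:P * 'X^j.
  by rewrite /trunc poly_def; apply: eq_bigr => j _; rewrite mul_polyC.
have -> (p : {poly R}) : p ^+ y = \prod_(i < y) p.
  by rewrite prodr_const card_ord.
rewrite bigA_distr_bigA coef_sum /iid_sum_mass big_mkcond/=.
apply: eq_bigr => f _; rewrite big_split/= prodrXr -rmorph_prod/= coefCM coefXn.
by rewrite eq_sym; case: eqP => _; rewrite ?mulr1 ?mulr0.
Qed.

Lemma iid_sum_mass_ge0 y z : 0 <= iid_sum_mass k y z.
Proof.
by apply: sumr_ge0 => x _; apply: prodr_ge0 => i _; exact: mass_ge0.
Qed.

Let cvg_series_finite (a : nat -> R) N : (forall i, (N <= i)%N -> a i = 0) ->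
  series a n @[n --> \oo] --> \sum_(i < N) a i.
Proof.
move=> aN; apply: cvg_near_cst; near=> n.
have Nn : (N <= n)%N by near: n; exact: nbhs_infty_ge.
rewrite /series/= (big_cat_nat (n := N))//= big_mkord big_nat_cond.
by rewrite [X in _ + X]big1 ?addr0// => i /andP[/andP[/aN]].
Unshelve. all: by end_near.
Qed.

(** The generating function of a sum of [y] independent variables with law [k]
    is a power. The powers of the truncations of [f] increase to [f ^ y], and
    each of their coefficients is eventually that of [f ^ y]. *)
Lemma cvg_series_iid_sum y v : 0 <= v <= 1 ->
  series (fun z => iid_sum_mass k y z * v ^+ z) n @[n --> \oo] --> gf k v ^+ y.
Proof.
move=> v01; have /andP[v0 v1] := v01.
have truncE N j : (trunc N)`_j = if (j < N)%N then mass k j else 0.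
  by rewrite coef_poly.
apply: (@cvg_series_interchange _ (fun N z => (trunc N ^+ y)`_z * v ^+ z) _
  (fun N => (trunc N).[v] ^+ y)).
- move=> N z; rewrite iid_sum_massE.
  suff /andP[h1 h2] : 0 <= (trunc N ^+ y)`_z <= (trunc z.+1 ^+ y)`_z.
    by rewrite mulr_ge0 ?exprn_ge0//= ler_wpM2r ?exprn_ge0.
  have [Nz|zN] := leqP N z.+1.
    apply: coef_pow_mono => j; rewrite !truncE; case: ltnP => jN.
      by rewrite (leq_trans jN Nz) mass_ge0 lexx.
    by case: ifP; rewrite lexx// mass_ge0.
  rewrite (@coef_pow_eq (trunc z.+1) (trunc N) y z z)//; last first.
    by move=> j jz; rewrite !truncE ltnS jz (leq_ltn_trans jz)// ltnW.
  have /andP[-> _] : 0 <= (trunc N ^+ y)`_z <= (trunc N ^+ y)`_z; last by rewrite lexx.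
  apply: coef_pow_mono => j; rewrite truncE lexx andbT.
  by case: ifP => // _; exact: mass_ge0.
- move=> z; apply: cvg_near_cst; near=> N.
  have zN : (z < N)%N by near: N; exact: nbhs_infty_gt.
  rewrite iid_sum_massE; congr (_ * _); apply: (@coef_pow_eq _ _ _ z) => //.
  by move=> j jz; rewrite !truncE ltnS jz (leq_ltn_trans jz).
- move=> N; rewrite -horner_exp horner_coef; apply: cvg_series_finite => i sizei.
  by rewrite nth_default ?mul0r.
- apply: cvg_expn; rewrite (_ : (fun N => _) =
    series (fun j => mass k j * v ^+ j)); first exact: cvg_gf.
  by apply/funext => N; rewrite horner_poly /series/= big_mkord.
Unshelve. all: by end_near.
Qed.

End IIDSum.

Section CountableValued.
Context {R : realType} {d : measure_display} {W : measurableType d}.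
Variables (T : countType) (f : W -> T).
Hypothesis mf : forall a, measurable (f @^-1` [set a]).

(** The fibers of [f], enumerated by [nat] and padded with empty sets, in the
    form that the countable additivity of the integral requires. *)
Definition fiber (i : nat) : set W :=
  if pickle_inv i is Some a then f @^-1` [set a] else set0.

Lemma measurable_fiber i : measurable (fiber i).
Proof. by rewrite /fiber; case: pickle_inv. Qed.

Lemma trivIset_fiber : trivIset setT fiber.
Proof.
apply/trivIsetP => i j _ _ ij; apply/seteqP; split=> // x; rewrite /fiber.
case Ei : (pickle_inv i) => [a|]; case Ej : (pickle_inv j) => [b|];
  [|by case..].
have := @pickle_invK T i; have := @pickle_invK T j; rewrite Ei Ej /= => bj ai.
by move=> [/= fa fb]; move: ij; rewrite -ai -bj -fa -fb eqxx.
Qed.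

Lemma bigcup_fiber : \bigcup_i fiber i = setT.
Proof.
apply/seteqP; split=> // x _; exists (pickle (f x)) => //=.
by rewrite /fiber pickleK_inv.
Qed.

Lemma measurable_countable_valued d' (U : measurableType d') (g : T -> U) :
  measurable_fun setT (g \o f).
Proof.
move=> _ B mB; rewrite setTI.
rewrite (_ : _ @^-1` B =
  \bigcup_(i in [set i | exists2 a, pickle_inv i = Some a & B (g a)]) fiber i).
  by apply: bigcup_measurable => i _; exact: measurable_fiber.
apply/seteqP; split=> x /=.
  by exists (pickle (f x)); [exists (f x)|]; rewrite ?/fiber ?pickleK_inv.
by move=> [i [a ia Ba]]; rewrite /fiber ia /= => ->.
Qed.

Lemma ge0_integral_fiber (mu : {measure set W -> \bar R}) (h : W -> \bar R)
    (D : set W) : measurable D ->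
  measurable_fun setT h -> (forall x, (0 <= h x)%E) ->
  (\int[mu]_(x in D) h x = \sum_(0 <= i <oo) \int[mu]_(x in D `&` fiber i) h x)%E.
Proof.
move=> mD mh h0; rewrite -{1}(setIT D) -bigcup_fiber setI_bigcupr.
rewrite ge0_integral_bigcup//.
- by move=> i; apply: measurableI => //; exact: measurable_fiber.
- exact: measurable_funTS.
- by apply: trivIset_setIl; exact: trivIset_fiber.
Qed.

End CountableValued.

Section Markov.
Context {R : realType} {d : measure_display} {W : measurableType d}.
Variables (mu : {measure set W -> \bar R}) (k : nat -> pprobability nat R)
  (Z : nat -> W -> nat).
Hypotheses (mZ : forall n, measurable_fun setT (Z n)).
Hypothesis muT : mu setT = 1%E.
Hypothesis muZ : branching_process mu k Z.

Lemma mu_fin_num A : measurable A -> mu A \is a fin_num.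
Proof.
move=> mA; rewrite ge0_fin_numE//; apply: (@le_lt_trans _ _ (mu setT)).
  by rewrite le_measure ?inE.
by rewrite muT ltry.
Qed.

Definition path_to (n : nat) (x : W) : seq nat := [seq Z i x | i <- iota 0 n.+1].

Lemma size_path_to n x : size (path_to n x) = n.+1.
Proof. by rewrite size_map size_iota. Qed.

Lemma nth_path_to n i x : (i <= n)%N -> nth 0%N (path_to n x) i = Z i x.
Proof.
by move=> iN; rewrite (nth_map 0%N) ?size_iota// nth_iota// add0n.
Qed.

Lemma path_toE n a : size a = n.+1 ->
  path_to n @^-1` [set a] = [set x | forall i, (i <= n)%N -> Z i x = nth 0%N a i].
Proof.
move=> sa; apply/seteqP; split=> x /=.
  by move=> <- i iN; rewrite nth_path_to.
move=> h; apply: (@eq_from_nth _ 0%N); first by rewrite size_path_to sa.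
by move=> i; rewrite size_path_to ltnS => iN; rewrite nth_path_to// h.
Qed.

Lemma path_toE0 n a : size a <> n.+1 -> path_to n @^-1` [set a] = set0.
Proof.
by move=> sa; apply/seteqP; split=> // x /= xa; rewrite -xa size_path_to in sa.
Qed.

Lemma measurable_Z n z : measurable (Z n @^-1` [set z]).
Proof. by rewrite -[X in measurable X]setTI; exact: mZ. Qed.

Lemma measurable_path_to n a : measurable (path_to n @^-1` [set a]).
Proof.
have [sa|sa] := eqVneq (size a) n.+1; last by rewrite path_toE0//; exact/eqP.
rewrite path_toE//.
rewrite (_ : [set x | _] = \bigcap_(i in `I_n.+1) (Z i @^-1` [set nth 0%N a i])).
  by apply: bigcap_measurableType => i _; exact: measurable_Z.
by apply/seteqP; split=> x /= h i; apply: h.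
Qed.

Lemma measurable_Z_fun n (g : nat -> R) : measurable_fun setT (g \o Z n).
Proof. exact/measurable_countable_valued/measurable_Z. Qed.

Lemma measurable_path_fun n (g : seq nat -> R) : measurable_fun setT (g \o path_to n).
Proof. exact/measurable_countable_valued/measurable_path_to. Qed.

Let integral_next n a v : size a = n.+1 -> 0 <= v <= 1 ->
  (\int[mu]_(x in path_to n @^-1` [set a]) (v ^+ Z n.+1 x)%:E =
   mu (path_to n @^-1` [set a]) * (gf (k n) v ^+ nth 0%N a n)%:E)%E.
Proof.
move=> sa v01; have /andP[v0 v1] := v01.
have mA := measurable_path_to n a.
set A := path_to n @^-1` [set a] in mA *.
have -> : (\int[mu]_(x in A) (v ^+ Z n.+1 x)%:E =
    \sum_(0 <= z <oo) \int[mu]_(x in A `&` Z n.+1 @^-1` [set z]) (v ^+ z)%:E)%E.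
  have AE : A = \bigcup_z (A `&` Z n.+1 @^-1` [set z]).
    by apply/seteqP; split=> [x Ax|x [z _ []//]]; exists (Z n.+1 x).
  rewrite {1}AE ge0_integral_bigcup//.
  - by apply: eq_eseriesr => z _; apply: eq_integral => x; rewrite inE => -[_ /= ->].
  - by move=> z; apply: measurableI => //; exact: measurable_Z.
  - by apply/measurable_EFinP; apply: measurable_funTS; exact: measurable_Z_fun.
  - by move=> x _; rewrite lee_fin exprn_ge0.
  - by apply: trivIset_setIl; exact: trivIset_preimage1.
have AZ z : mu (A `&` Z n.+1 @^-1` [set z]) =
    (mu A * (iid_sum_mass (k n) (nth 0%N a n) z)%:E)%E.
  pose zz i := if (i <= n)%N then nth 0%N a i else z.
  have zzn : zz n = nth 0%N a n by rewrite /zz leqnn.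
  have zzS : zz n.+1 = z by rewrite /zz ltnn.
  have := muZ.2 n zz; rewrite zzn zzS.
  rewrite (_ : [set x | _] = A `&` Z n.+1 @^-1` [set z]); last first.
    rewrite /A path_toE//; apply/seteqP; split=> x /=.
      move=> h; split=> [i iN|]; last by rewrite h.
      by rewrite h ?leqW// /zz iN.
    move=> [h1 h2] i; rewrite leq_eqVlt => /orP[/eqP ->|].
      by rewrite /zz ltnn.
    by rewrite ltnS => iN; rewrite /zz iN h1.
  move=> ->; congr (mu _ * _)%E.
  by rewrite /A path_toE//; apply/seteqP; split=> x /= h i iN; rewrite h// /zz iN.
transitivity (\sum_(0 <= z <oo)
    (mu A * (iid_sum_mass (k n) (nth 0%N a n) z * v ^+ z)%:E))%E.
  apply: eq_eseriesr => z _; rewrite integral_cst ?AZ; last first.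
    by apply: measurableI => //; exact: measurable_Z.
  by rewrite muleCA -EFinM mulrC.
rewrite -(fineK (mu_fin_num mA)) nneseriesZl; last first.
  by move=> z _; rewrite lee_fin mulr_ge0 ?iid_sum_mass_ge0 ?exprn_ge0.
by rewrite (cvg_series_EFin (@cvg_series_iid_sum _ _ _ _ v01)).
Qed.

(** The Markov property, tested on powers: given the path up to time [n],
    [Z_(n+1)] is a sum of [Z_n] independent variables. The factor [G] depends
    on the whole path, so that it can be a power of an earlier generation or the
    indicator of an earlier event. *)
Lemma integral_markov n (G : seq nat -> R) v : (forall a, 0 <= G a) -> 0 <= v <= 1 ->
  (\int[mu]_x (G (path_to n x) * v ^+ Z n.+1 x)%:E =
   \int[mu]_x (G (path_to n x) * gf (k n) v ^+ Z n x)%:E)%E.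
Proof.
move=> G0 v01; have /andP[v0 v1] := v01.
have g0 := gf_ge0 (k n) v0.
rewrite !(ge0_integral_fiber (measurable_path_to n))//; last first.
- by move=> x; rewrite lee_fin mulr_ge0 ?exprn_ge0.
- apply/measurable_EFinP; apply: measurable_funM; first exact: measurable_path_fun.
  exact: measurable_Z_fun (fun z => v ^+ z).
- by move=> x; rewrite lee_fin mulr_ge0 ?exprn_ge0.
- apply/measurable_EFinP; apply: measurable_funM; first exact: measurable_path_fun.
  exact: measurable_Z_fun (fun z => gf (k n) v ^+ z).
apply: eq_eseriesr => i _; rewrite setTI /fiber.
case: pickle_inv => [a|]; last by rewrite !integral_set0.
have [sa|/eqP sa] := eqVneq (size a) n.+1; last by rewrite path_toE0// !integral_set0.
have mA := measurable_path_to n a.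
transitivity (\int[mu]_(x in path_to n @^-1` [set a])
    ((G a)%:E * (v ^+ Z n.+1 x)%:E))%E.
  by apply: eq_integral => x; rewrite inE/= => ->; rewrite EFinM.
rewrite ge0_integralZl_EFin//; last 2 first.
- by move=> x _; rewrite lee_fin exprn_ge0.
- apply/measurable_EFinP; apply: measurable_funTS.
  exact: measurable_Z_fun (fun z => v ^+ z).
rewrite integral_next//.
transitivity (\int[mu]_(x in path_to n @^-1` [set a])
    (G a * gf (k n) v ^+ nth 0%N a n)%:E)%E.
  by rewrite integral_cst// EFinM muleA [(_ * mu _)%E]muleC -muleA muleC.
apply: eq_integral => x; rewrite inE/= => <-.
by rewrite nth_path_to.
Qed.

End Markov.

Lemma first_timeP (p : pred nat) n :
  first_time p = Some n <-> p n /\ forall i, (i < n)%N -> ~~ p i.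
Proof.
rewrite /first_time; case: pselect => [h|h]; last first.
  by split=> // -[pn _]; exfalso; apply: h; exists n.
case: ex_minnP => j pj jmin; split=> [[<-]|[pn nmin]].
  split=> // i ij; apply/negP => /jmin; rewrite leqNgt ij//.
congr Some; apply/eqP; rewrite eqn_leq jmin//= leqNgt; apply/negP.
by move=> /nmin; rewrite pj.
Qed.

Section Transform.
Context {R : realType} {d : measure_display} {W : measurableType d}.
Variables (mu : {measure set W -> \bar R}) (k : nat -> pprobability nat R)
  (Z : nat -> W -> nat).
Hypotheses (mZ : forall n, measurable_fun setT (Z n)).
Hypothesis muT : mu setT = 1%E.
Hypothesis muZ : branching_process mu k Z.

Let gf01 e (v : R) : 0 <= v <= 1 -> 0 <= gf e v <= 1.
Proof. by move=> v01; rewrite gf_le1// gf_ge0//; case/andP: v01. Qed.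

Lemma gf_compSr m n v : (m <= n)%N ->
  gf_comp k m n.+1 v = gf_comp k m n (gf (k n) v).
Proof.
move=> mn; rewrite !(gf_comp_shift k m) subSn// gf_compS/=.
by rewrite subnKC.
Qed.

Let mpow n (v : R) : measurable_fun setT (fun x => v ^+ Z n x).
Proof. exact: (measurable_Z_fun mZ n (fun z => v ^+ z)). Qed.

Let ae_null (N Q : set W) : measurable N -> mu N = 0%E ->
  (forall x, ~ N x -> Q x) -> {ae mu, forall x, Q x}.
Proof.
by move=> mN N0 NQ; exists N; split=> // x; apply: contra_notP => /NQ.
Qed.

Let mu_setC B : measurable B -> mu (~` B) = (1 - mu B)%E.
Proof.
move=> mB; rewrite -setTD measureD//; last by rewrite -ge0_fin_numE// (mu_fin_num muT).
by rewrite setTI; congr (_ - _)%E.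
Qed.

Lemma integral_pow m v : 0 <= v <= 1 ->
  (\int[mu]_x (v ^+ Z m x)%:E = (gf_comp k 0 m v)%:E)%E.
Proof.
elim: m v => [|m IH] v v01.
  have m1 : measurable [set x | Z 0 x = 1%N] by exact: (measurable_Z mZ 0 1).
  transitivity (\int[mu]_x (cst v%:E x))%E; last first.
    by rewrite integral_cst// muT mule1.
  apply: ae_eq_integral => //; first exact/measurable_EFinP.
  apply: (@ae_null (~` [set x | Z 0 x = 1%N])).
  - exact: measurableC.
  - by rewrite mu_setC// muZ.1 subee.
  - by move=> x /contrapT /= -> _; rewrite expr1.
have := integral_markov mZ muT muZ m (G := fun=> 1) (fun=> ler01) v01.
under eq_integral do rewrite mul1r.
move=> ->; under eq_integral do rewrite mul1r.
by rewrite IH ?gf01// gf_compSr.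
Qed.

(** The Markov property removes the generations after [m] one by one, from the
    last one on. *)
Lemma integral_pow_pair m n s v : (m <= n)%N -> 0 <= s <= 1 -> 0 <= v <= 1 ->
  (\int[mu]_x (s ^+ Z m x * v ^+ Z n x)%:E =
   (gf_comp k 0 m (s * gf_comp k m n v))%:E)%E.
Proof.
move=> mn s01; elim: n mn v => [|n IH] mn v v01.
  move: mn; rewrite leqn0 => /eqP ->; rewrite /gf_comp/=.
  under eq_integral do rewrite -exprMn.
  rewrite integral_pow//; case/andP: s01 => s0 s1; case/andP: v01 => v0 v1.
  by rewrite mulr_ge0//= mulr_ile1.
move: mn; rewrite leq_eqVlt => /orP[/eqP mn|].
  rewrite -mn /gf_comp /index_iota subnn/=.
  under eq_integral do rewrite -exprMn.
  rewrite integral_pow//; case/andP: s01 => s0 s1; case/andP: v01 => v0 v1.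
  by rewrite mulr_ge0//= mulr_ile1.
rewrite ltnS => mn; rewrite gf_compSr// -IH ?gf01//.
pose G (a : seq nat) : R := s ^+ nth 0%N a m.
have GE x : G (path_to Z n x) = s ^+ Z m x by rewrite /G nth_path_to.
have G0 a : 0 <= G a by rewrite exprn_ge0//; case/andP: s01.
transitivity (\int[mu]_x (G (path_to Z n x) * v ^+ Z n.+1 x)%:E)%E.
  by apply: eq_integral => x _; rewrite GE.
rewrite (integral_markov mZ muT muZ)//.
by apply: eq_integral => x _; rewrite GE.
Qed.

Let indicZ j z x : \1_(Z j @^-1` [set z]) x = (Z j x == z)%:R :> R.
Proof. by rewrite indicE; congr (nat_of_bool _)%:R; apply/idP/eqP; rewrite inE. Qed.

(** Zero is absorbing: the Markov property at [v = 0], where [0 ^ Z] is the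
    indicator of [Z = 0]. *)
Let alive_zero j : mu (Z j @^-1` [set 0%N] `\` Z j.+1 @^-1` [set 0%N]) = 0%E.
Proof.
have mZ0 i := measurable_Z mZ i 0%N.
have v01 : 0 <= (0 : R) <= 1 by rewrite lexx/=.
have G0 (a : seq nat) : 0 <= (nth 0%N a j == 0%N)%:R :> R by exact: ler0n.
have e : (\int[mu]_x (\1_(Z j @^-1` [set 0%N] `&` Z j.+1 @^-1` [set 0%N]) x)%:E =
    \int[mu]_x (\1_(Z j @^-1` [set 0%N]) x)%:E :> \bar R)%E.
  transitivity (\int[mu]_x ((nth 0%N (path_to Z j x) j == 0%N)%:R * 0 ^+ Z j.+1 x)%:E)%E.
    by apply: eq_integral => x _; rewrite nth_path_to// expr0n indicI/= !indicZ.
  rewrite (integral_markov mZ muT muZ j G0 v01).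
  apply: eq_integral => x _; rewrite nth_path_to// indicZ.
  by case: (eqVneq (Z j x) 0%N) => [->|_]; rewrite ?mul0r// expr0 mulr1.
move: e; rewrite !integral_indic// ?setIT; last exact: measurableI.
move=> e; transitivity (mu (Z j @^-1` [set 0%N]) -
    mu (Z j @^-1` [set 0%N] `&` Z j.+1 @^-1` [set 0%N]))%E.
  by apply: measureD => //; rewrite -ge0_fin_numE// (mu_fin_num muT).
by rewrite e subee// (mu_fin_num muT).
Qed.

Lemma measurable_extinct_at n : measurable (extinct_at Z n).
Proof.
rewrite (_ : extinct_at Z n = Z n @^-1` [set 0%N] `&`
    \bigcap_(i in `I_n) ~` (Z i @^-1` [set 0%N])).
  apply: measurableI; first exact: measurable_Z.
  by apply: bigcap_measurableType => i _; apply/measurableC/measurable_Z.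
apply/seteqP; split=> x; rewrite /extinct_at /extinction_time /=.
  move=> /first_timeP[/eqP Zn h]; split=> // i /= /h /eqP //.
by move=> [Zn h]; apply/first_timeP; split=> [|i /h /eqP//]; exact/eqP.
Qed.

Let integral_extinct m n s : (m <= n)%N -> 0 <= s <= 1 ->
  (\int[mu]_(x in extinct_at Z n.+1) (s ^+ Z m x)%:E =
   (gf_comp k 0 m (s * gf_comp k m n.+1 0) -
    gf_comp k 0 m (s * gf_comp k m n 0))%:E)%E.
Proof.
move=> mn s01; have /andP[s0 s1] := s01.
have mA := measurable_extinct_at n.+1.
have v01 : 0 <= (0 : R) <= 1 by rewrite lexx/=.
have fin j : (m <= j)%N ->
   (\int[mu]_x (s ^+ Z m x * 0 ^+ Z j x)%:E)%E \is a fin_num.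
  by move=> mj; rewrite integral_pow_pair.
rewrite EFinB -!integral_pow_pair ?leqW//.
have mA' : measurable_fun setT (fun x => (s ^+ Z m x * \1_(extinct_at Z n.+1) x)%:E).
  by apply/measurable_EFinP; apply: measurable_funM => //; exact: measurable_indic.
have mj j : measurable_fun setT (fun x => (s ^+ Z m x * 0 ^+ Z j x)%:E).
  by apply/measurable_EFinP; exact: measurable_funM.
transitivity (\int[mu]_x (s ^+ Z m x * \1_(extinct_at Z n.+1) x)%:E)%E.
  rewrite integral_mkcond; apply: eq_integral => x _; rewrite patchE indicE.
  by case: ifP => _; rewrite ?mulr1 ?mulr0.
apply/esym/eqP; rewrite sube_eq; last 2 first.
- by rewrite fin// leqW.
- by rewrite fin_num_adde_defl// fin.
rewrite -ge0_integralD//; last 2 first.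
- by move=> x _; rewrite lee_fin mulr_ge0 ?exprn_ge0 ?indicE.
- by move=> x _; rewrite lee_fin mulr_ge0 ?exprn_ge0.
apply/eqP/ae_eq_integral => //.
  exact: emeasurable_funD.
apply: (@ae_null (\bigcup_j (Z j @^-1` [set 0%N] `\` Z j.+1 @^-1` [set 0%N]))).
- by apply: bigcupT_measurable => j; apply: measurableD; exact: measurable_Z.
- apply/eqP; rewrite -measure_le0.
  apply: le_trans (generalized_Boole_inequality mu _ _) _.
  + by move=> j; apply: measurableD; exact: measurable_Z.
  + by apply: bigcupT_measurable => j; apply: measurableD; exact: measurable_Z.
  + by rewrite eseries0// => j _ _; exact: alive_zero.
move=> x Nx _.
have absorb j : Z j x = 0%N -> Z j.+1 x = 0%N.
  by move=> Zj; apply: contrapT => Zj1; apply: Nx; exists j.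
have absorb_le i j : (i <= j)%N -> Z i x = 0%N -> Z j x = 0%N.
  by move=> /subnK <-; elim: (j - i)%N => [//|l IH] /IH; exact: absorb.
rewrite -EFinD -mulrDr; congr (_ * _)%:E; rewrite !expr0n indicE.
have [Zn|Zn] := eqVneq (Z n x) 0%N.
  rewrite (absorb _ Zn) eqxx memNset ?add0r//.
  rewrite /extinct_at /extinction_time/= => /first_timeP[_ /(_ n (ltnSn n))].
  by rewrite Zn.
rewrite addr0; congr (nat_of_bool _)%:R; apply/eqP/idP => [Zn1|].
  rewrite inE; apply/first_timeP; split=> [|i]; first exact/eqP.
  by rewrite ltnS => iN; apply/eqP => /(absorb_le _ _ iN); exact/eqP.
by rewrite inE => /first_timeP[/eqP].
Qed.

Lemma measure_extinct_at m n : (m <= n)%N ->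
  mu (extinct_at Z n.+1) =
  (gf_comp k 0 m (gf_comp k m n.+1 0) - gf_comp k 0 m (gf_comp k m n 0))%:E.
Proof.
move=> mn; have := integral_extinct mn (s := 1); rewrite !mul1r ler01 lexx => <-//.
under eq_integral do rewrite expr1n.
by rewrite integral_cst ?mul1e//; exact: measurable_extinct_at.
Qed.

(** On [T = n] the process is zero at time [n] but not before, and zero is
    absorbing: the transform on [T = n] is a difference of transforms. *)
Lemma cond_expectation_extinct m n s : (m <= n)%N -> 0 <= s <= 1 ->
  cond_expectation mu (fun x => s ^+ Z m x) (extinct_at Z n.+1) =
  (gf_comp k 0 m (s * gf_comp k m n.+1 0) -
     gf_comp k 0 m (s * gf_comp k m n 0)) /
  (gf_comp k 0 m (gf_comp k m n.+1 0) - gf_comp k 0 m (gf_comp k m n 0)).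
Proof.
move=> mn s01; rewrite /cond_expectation /Rintegral integral_extinct//.
by rewrite (measure_extinct_at mn).
Qed.

End Transform.

(** * Measurability in the environment *)
Section Measurability.
Context {R : realType} {d : measure_display} {T : measurableType d}.
Implicit Types (K : T -> pprobability nat R) (g : T -> R).

Lemma measurable_mass K j : measurable_fun setT K ->
  measurable_fun setT (fun x => mass (K x) j).
Proof.
move=> mK; apply: measurableT_comp; first exact: fine_measurable.
exact: (@measurable_kernel _ _ _ _ _ (kprobability mK) [set j]).
Qed.

Lemma measurable_power_sum (c : T -> nat -> R) (g : T -> R) :
  (forall j, measurable_fun setT (c ^~ j)) -> (forall x j, 0 <= c x j) ->
  measurable_fun setT g -> (forall x, 0 <= g x) ->
  measurable_fun setT (fun x => power_sum (c x) (g x)).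
Proof.
move=> mc c0 mg g0; rewrite /power_sum.
apply: measurableT_comp; first exact: fine_measurable.
apply: ge0_emeasurable_sum => [j x _ _|j _].
  by rewrite lee_fin mulr_ge0 ?exprn_ge0.
by apply/measurable_EFinP/measurable_funM => //; exact: measurable_funX.
Qed.

Lemma measurable_gf K g : measurable_fun setT K -> measurable_fun setT g ->
  (forall x, 0 <= g x) -> measurable_fun setT (fun x => gf (K x) (g x)).
Proof.
move=> mK mg g0; apply: measurable_power_sum => // [j|x j].
  exact: measurable_mass.
exact: mass_ge0.
Qed.

Lemma measurable_gf' K : measurable_fun setT K ->
  measurable_fun setT (fun x => gf' (K x) 1).
Proof.
move=> mK; apply: measurable_power_sum => // [j|x j]; rewrite /pseries_diffs.
  by apply: measurable_funM => //; exact: measurable_mass.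
by rewrite mulr_ge0 ?mass_ge0.
Qed.

Lemma measurable_gf'' K : measurable_fun setT K ->
  measurable_fun setT (fun x => gf'' (K x) 1).
Proof.
move=> mK; apply: measurable_power_sum => // [j|x j]; rewrite /pseries_diffs.
  by do 2 apply: measurable_funM => //; exact: measurable_mass.
by rewrite !mulr_ge0 ?mass_ge0.
Qed.

Lemma measurable_inv (g : T -> R) : measurable_fun setT g ->
  measurable_fun setT (fun x => (g x)^-1).
Proof.
(* [x^-1 = x / |x| ^ 2], also at [x = 0] *)
move=> mg; rewrite (_ : (fun x => _) = (fun x => g x * (`|g x| `^ (-1)) ^+ 2)).
  apply: measurable_funM => //; apply: measurable_funX.
  apply: (measurableT_comp (f := fun a : R => a `^ (-1)) (g := fun x => `|g x|)).
    exact: measurable_powR.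
  exact: measurableT_comp.
apply/funext => x; rewrite powR_inv1 ?normr_ge0// exprVn -normrX ger0_norm ?sqr_ge0//.
have [->|g0] := eqVneq (g x) 0; first by rewrite invr0 mul0r.
by rewrite expr2 invfM mulrA mulfV// mul1r.
Qed.

Lemma measurable_gf_comp (k : nat -> T -> pprobability nat R) m n :
  (forall i, measurable_fun setT (k i)) ->
  measurable_fun setT (fun x => gf_comp (fun i => k i x) m n 0).
Proof.
move=> mk; rewrite /gf_comp; elim: index_iota => [|i s IH] //=.
apply: measurable_gf => // x; elim: s {IH} => //= j s; exact: gf_ge0.
Qed.

Lemma measurable_walk (k : nat -> T -> pprobability nat R) n :
  (forall i, measurable_fun setT (k i)) ->
  measurable_fun setT (fun x => walk (fun i => k i x) n).
Proof.
move=> mk; apply: measurable_sum => i.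
by apply: measurableT_comp => //; exact: measurable_gf'.
Qed.

Lemma measurable_half_eta K : measurable_fun setT K ->
  measurable_fun setT (fun x => half_eta (K x)).
Proof.
move=> mK; apply: measurable_funM => //; apply: measurable_funM.
  exact: measurable_gf''.
by apply: measurable_inv; apply: measurable_funX; exact: measurable_gf'.
Qed.

Lemma measurable_bsum (k : nat -> T -> pprobability nat R) n :
  (forall i, measurable_fun setT (k i)) ->
  measurable_fun setT (fun x => bsum (fun i => k i x) n).
Proof.
move=> mk; under eq_fun do rewrite bsumE.
apply: measurable_sum => i; apply: measurable_funM.
  exact: measurable_half_eta.
by apply: measurableT_comp => //; apply: measurableT_comp => //; exact: measurable_walk.
Qed.

Lemma measurable_Onorm (k : nat -> T -> pprobability nat R) m n :
  (forall i, measurable_fun setT (k i)) ->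
  measurable_fun setT (fun x => Onorm (fun i => k i x) m n).
Proof.
move=> mk; have mg a b := measurable_gf_comp a b mk.
apply: measurable_funM; last exact: measurable_bsum.
apply: measurable_funM => //; apply: measurable_funM; first exact: measurable_funB.
by apply: measurable_inv; exact: measurable_funB.
Qed.

Lemma measurable_extinction_odds K : measurable_fun setT K ->
  measurable_fun setT (fun x => extinction_odds (K x)).
Proof.
move=> mK; have mg : measurable_fun setT (fun x => gf (K x) 0).
  exact: measurable_gf.
by apply: measurable_funM => //; apply: measurable_inv; exact: measurable_funB.
Qed.

End Measurability.

Section MeasurableConditioning.
Context {R : realType} {d d' : measure_display} {T : measurableType d}
  {W : measurableType d'}.
Variables (Pk : R.-pker T ~> W) (A : set W) (Z : W -> nat) (g : T -> nat -> R).
Hypotheses (mA : measurable A) (mZ : measurable_fun setT Z).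
Hypotheses (mg : forall z, measurable_fun setT (g ^~ z)).
Hypothesis g0 : forall x z, 0 <= g x z.

Let mZz z : measurable (A `&` Z @^-1` [set z]).
Proof.
by apply: measurableI => //; rewrite -[X in measurable X]setTI; exact: mZ.
Qed.

(** The integral is a series over the values of [Z], with measurable terms. *)
Lemma measurable_cond_expectation :
  measurable_fun setT
    (fun x => cond_expectation (Pk x) (fun y => g x (Z y)) A).
Proof.
rewrite /cond_expectation; apply: measurable_funM; last first.
  apply: measurable_inv; apply: measurableT_comp; first exact: fine_measurable.
  exact: measurable_kernel.
apply: measurableT_comp; first exact: fine_measurable.
rewrite (_ : (fun x => _) = (fun x =>
  \sum_(0 <= z <oo) (g x z)%:E * Pk x (A `&` Z @^-1` [set z]))%E).
  apply: ge0_emeasurable_sum => [z x _ _|z _]; first by rewrite mule_ge0 ?lee_fin.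
  apply: emeasurable_funM; first exact/measurable_EFinP.
  exact: measurable_kernel.
apply/funext => x.
have AE : A = \bigcup_z (A `&` Z @^-1` [set z]).
  by apply/seteqP; split=> [y Ay|y [z _ []//]]; exists (Z y).
rewrite {1}AE ge0_integral_bigcup//.
- apply: eq_eseriesr => z _; rewrite -integral_cst//.
  by apply: eq_integral => y; rewrite inE => -[_ /= ->].
- apply/measurable_EFinP; apply: measurable_funTS.
  by apply: (measurableT_comp (f := g x)) => //.
- by move=> y _; rewrite lee_fin.
- by apply: trivIset_setIl; exact: trivIset_preimage1.
Qed.

End MeasurableConditioning.

(** * The conditional transform in a fixed environment *)
Lemma normalizer_estimate {R : realType} (A b u v del : R) :
  0 < A -> 0 < b -> 0 <= v -> v < u -> u < 1 -> del <= 2^-1 ->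
  A / b <= del -> 1 - v <= del -> (u - v) / (1 - v) <= del ->
  let O x := x * b / (A + b * (1 - x)) in
  [/\ 0 < O u, (O u)^-1 <= 4 * del, 0 <= O v / O u <= 1 &
      1 - O v / O u <= 3 * del].
Proof.
move=> A0 b0 v0 vu u1 del2 Ab v1 uv O.
have v12 : 2^-1 <= v by lra.
have u0 : 0 < u by lra.
have vlt1 : v < 1 by exact: lt_trans u1.
have hu : 0 < A + b * (1 - u) by nra.
have hv : 0 < A + b * (1 - v) by nra.
have Ou : 0 < O u by rewrite divr_gt0 ?mulr_gt0.
have Ov : 0 <= O v by rewrite divr_ge0 ?ltW ?mulr_gt0//; lra.
have ui : u^-1 <= 2 by rewrite -[2]invrK lef_pV2 ?posrE; lra.
have rho : O v / O u = (v / u) * ((A + b * (1 - u)) / (A + b * (1 - v))).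
  by rewrite /O; field; rewrite !gt_eqF.
have vu1 : v / u <= 1 by rewrite ler_pdivrMr// mul1r ltW.
have vu0 : 0 <= v / u by rewrite divr_ge0// ltW.
have ab1 : (A + b * (1 - u)) / (A + b * (1 - v)) <= 1.
  by rewrite ler_pdivrMr//; nra.
have ab0 : 0 <= (A + b * (1 - u)) / (A + b * (1 - v)) by rewrite divr_ge0 ?ltW.
have h1 : 1 - v / u <= 2 * del.
  have -> : 1 - v / u = (u - v) * u^-1 by field; rewrite gt_eqF.
  apply: (@le_trans _ _ ((u - v) * 2)); first by rewrite ler_wpM2l//; lra.
  by lra.
have h2 : 1 - (A + b * (1 - u)) / (A + b * (1 - v)) <= del.
  have -> : 1 - (A + b * (1 - u)) / (A + b * (1 - v)) =
      (u - v) / (A / b + (1 - v)).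
    have : 0 < A / b + (1 - v) by rewrite addr_gt0 ?divr_gt0 ?subr_gt0.
    by move=> h; field; rewrite !gt_eqF// mulrC.
  apply: le_trans uv; rewrite ler_wpM2l//; first lra.
  rewrite lef_pV2 ?posrE ?subr_gt0//; first by rewrite lerDr divr_ge0// ltW.
  by rewrite addr_gt0 ?divr_gt0 ?subr_gt0.
split => //.
- have -> : (O u)^-1 = (A / b + (1 - u)) * u^-1.
    by rewrite /O; field; rewrite !gt_eqF.
  have Ab0 : 0 <= A / b by rewrite divr_ge0 ?ltW.
  apply: (@le_trans _ _ ((A / b + (1 - u)) * 2)); last lra.
  by rewrite ler_wpM2l//; lra.
- by rewrite divr_ge0 ?(ltW Ou)//= rho mulr_ile1.
- by rewrite rho; nra.
Qed.

Section QuenchedEstimate.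
Context {R : realType} {d : measure_display} {W : measurableType d}.
Variables (mu : {measure set W -> \bar R}) (k : nat -> pprobability nat R)
  (Z : nat -> W -> nat).
Hypotheses (mZ : forall n, measurable_fun setT (Z n)).
Hypothesis muT : mu setT = 1%E.
Hypothesis muZ : branching_process mu k Z.
Hypothesis FLk : forall i, fractional_linear (k i).
Hypothesis meank : forall i, 0 < gf' (k i) 1.
Hypothesis mu_extinct : forall n, (0 < n)%N -> (0 < mu (extinct_at Z n))%E.

Lemma gf_comp_mobius m x : 0 <= x < 1 ->
  gf_comp k 0 m x = mobius (expR (- walk k m)) (bsum k m) x.
Proof.
move=> x01; rewrite /mobius -(inv_gf_comp FLk meank m x01) invrK; ring.
Qed.

(** The conditioning at time [n] compares [u = f_(m,n)(0)] with
    [v = f_(m,n-1)(0)]. The three quantities assumed small control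
    [e^(-S_m) / b_m], [1 - v] and [(u - v) / (1 - v)]; together they make the
    normalization large and nearly the same at [u] and at [v]. *)
Lemma quenched_estimate lambda del m l : 0 < lambda -> (0 < m)%N -> (0 < l)%N ->
  let k' := k \o addn m in
  let n := (m + l).+1 in
  del <= 2^-1 ->
  (expR (walk k m) * bsum k m)^-1 <= del ->
  (bsum k' l)^-1 <= del ->
  extinction_odds (k' l) / (expR (walk k' l) * bsum k' l) <= del ->
  `|cond_expectation mu
      (fun x => expR (- (lambda * ((Z m x)%:R / Onorm k m n)))) (extinct_at Z n)
    - (1 + lambda) ^- 2| <=
  (4 * (lambda + 2 * lambda ^+ 2) + 3 * lambda) * del.
Proof.
move=> l0 m0 ll0 k' n del2 h1 h2 h3.
have FLk' i : fractional_linear (k' i) by exact: FLk.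
have meank' i : 0 < gf' (k' i) 1 by exact: meank.
have z01 : 0 <= (0 : R) < 1 by rewrite lexx/=.
have uE : gf_comp k m n 0 = gf_comp k' 0 l.+1 0.
  by rewrite gf_comp_shift /n -addnS addKn.
have vE : gf_comp k m (m + l) 0 = gf_comp k' 0 l 0.
  by rewrite gf_comp_shift addKn.
have := survival_le FLk' meank' ll0; have := survival_increment FLk' meank' ll0.
have := gf_comp0_nd FLk' meank' l.
have /andP[] := gf_comp_bounds FLk' meank' l.+1 z01.
have /andP[] := gf_comp_bounds FLk' meank' l z01.
rewrite -uE -vE; set u := gf_comp k m n 0; set v := gf_comp k m (m + l) 0.
move=> v0 v1 u0 u1 vu incr surv.
have b0 := bsum_gt0 FLk meank m0.
have A0 := expR_gt0 (- walk k m).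
have F x : 0 <= x < 1 -> gf_comp k 0 m x =
  mobius (expR (- walk k m)) (bsum k m) x := @gf_comp_mobius m x.
have v_lt_u : v < u.
  rewrite lt_neqAle vu andbT; apply/eqP => uv.
  have := mu_extinct (ltn0Sn (m + l)).
  by rewrite (measure_extinct_at mZ muT muZ (leq_addr l m)) -/n -/u -/v uv subrr ltxx.
have OE : Onorm k m n = u * bsum k m / (expR (- walk k m) + bsum k m * (1 - u)).
  rewrite /Onorm (@gf_comp_cat _ k m n 0) ?leqW ?leq_addr// -/u F ?u0// /mobius.
  have hu : 0 < expR (- walk k m) + bsum k m * (1 - u) by nra.
  by field; rewrite !gt_eqF ?subr_gt0.
have Ab : expR (- walk k m) / bsum k m <= del by rewrite expRN -invfM.
have [] := normalizer_estimate A0 b0 v0 v_lt_u u1 del2 Ab (le_trans surv h2)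
  (le_trans incr h3).
rewrite -OE; set Ov := v * bsum k m / _ => O0 Oinv /andP[rho0 rho1] rho_le.
set O := Onorm k m n in OE O0 Oinv rho0 rho1 rho_le *.
pose s := expR (- (lambda * O^-1)).
have -> : (fun x => expR (- (lambda * ((Z m x)%:R / O)))) = (fun x => s ^+ Z m x).
  apply/funext => x; rewrite /s -expRM_natl; congr expR.
  by rewrite mulrN mulrCA.
have s0 : 0 < s by exact: expR_gt0.
have s1 : s <= 1 by rewrite /s -expR0 ler_expR oppr_le0 mulr_ge0 ?invr_ge0 ?ltW.
rewrite (cond_expectation_extinct mZ muT muZ (leq_addr l m)) ?s1 ?(ltW s0)//.
rewrite -/n -/u -/v !F ?u0 ?v0 ?mulr_ge0 ?(ltW s0)//=; last 2 first.
- by apply: le_lt_trans v1; rewrite ler_piMl.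
- by apply: le_lt_trans u1; rewrite ler_piMl.
rewrite mobius_ratio// -OE -/Ov.
have := transform_error l0 (y := O^-1) (rho := Ov / O).
rewrite invr_gt0 invrK divfK ?gt_eqF// => /(_ O0 rho0 rho1) h.
have c0 : 0 <= lambda + 2 * lambda ^+ 2.
  by rewrite addr_ge0 ?mulr_ge0 ?exprn_ge0 ?ltW.
apply: (le_trans h).
have -> : (4 * (lambda + 2 * lambda ^+ 2) + 3 * lambda) * del =
  (lambda + 2 * lambda ^+ 2) * (4 * del) + lambda * (3 * del) by ring.
by apply: lerD; rewrite ler_wpM2l// ltW.
Qed.

End QuenchedEstimate.

(** * The limit in probability *)
Section ErealSequences.
Context {R : realType}.
Implicit Types (a : nat -> \bar R).

Lemma cvge0_near_le a (eps : R) : a n @[n --> \oo] --> 0%E -> 0 < eps ->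
  \forall n \near \oo, (a n <= eps%:E)%E.
Proof.
move=> /fine_cvgP[fin /cvgrPdist_le h] e0; near=> n.
have an : a n \is a fin_num by near: n.
rewrite -(fineK an) lee_fin; apply: le_trans (ler_norm _) _.
by rewrite -normrN -sub0r; near: n; exact: h.
Unshelve. all: by end_near.
Qed.

Lemma near_le_cvge0 a : (forall n, (0 <= a n)%E) ->
  (forall eps : R, 0 < eps -> \forall n \near \oo, (a n <= eps%:E)%E) ->
  a n @[n --> \oo] --> 0%E.
Proof.
move=> a0 h; apply/fine_cvgP; split.
  near=> n; rewrite ge0_fin_numE//; apply: (@le_lt_trans _ _ 1%:E); last exact: ltry.
  by near: n; exact: h.
apply/cvgrPdist_le => eps e0; near=> n.
have an : (a n <= eps%:E)%E by near: n; exact: h.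
rewrite sub0r normrN ger0_norm ?fine_ge0// -lee_fin fineK//.
by rewrite ge0_fin_numE// (le_lt_trans an)// ltry.
Unshelve. all: by end_near.
Qed.

(** Both the time [m = [nt]] and the remaining time [l] before the last
    generation tend to infinity, since [0 < t < 1]. *)
Lemma near_split_time (t : R) N : 0 < t < 1 -> \forall n \near \oo,
  exists l, let m := Num.truncn (n%:R * t) in
    [/\ (N <= m)%N, (N <= l)%N & n = (m + l).+1].
Proof.
move=> /andP[t0 t1]; near=> n.
have nt : 0 <= n%:R * t by rewrite mulr_ge0// ltW.
exists (n - (Num.truncn (n%:R * t)).+1)%N => /=.
have hN : (N <= Num.truncn (n%:R * t))%N.
  rewrite truncn_ge_nat// -ler_pdivrMr//; apply: ltW.
  by near: n; exact: nbhs_infty_gtr.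
have hl : (Num.truncn (n%:R * t) + N.+1 <= n)%N.
  rewrite -(ler_nat R) natrD; apply: (@le_trans _ _ (n%:R * t + N.+1%:R)).
    by rewrite lerD2r truncn_le.
  rewrite -lerBrDl -[X in X - _]mulr1 -mulrBr -ler_pdivrMr ?subr_gt0//.
  by apply: ltW; near: n; exact: nbhs_infty_gtr.
by split; lia.
Unshelve. all: by end_near.
Qed.

End ErealSequences.

Section IIDEnvironment.
Context {R : realType} {d : measure_display} {Omega : measurableType d}.
Variables (P : probability Omega R) (K : {mfun Omega >-> pprobability nat R})
  (Kn : nat -> {mfun Omega >-> pprobability nat R}).
Hypothesis KnK : iid_copies P K Kn.

Let env (w : Omega) (n : nat) : pprobability nat R := Kn n w.
Let phi (e : pprobability nat R) : R := ln (gf' e 1).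
Let seqE := g_sigma_algebraType (@all_boxes _ (pprobability nat R)).

Lemma iid_ae (Q : set (pprobability nat R)) : measurable Q ->
  {ae P, forall w, Q (K w)} -> {ae P, forall w, forall n, Q (env w n)}.
Proof.
move=> mQ QK; apply: ae_foralln => n.
have mKQ (f : {mfun Omega >-> pprobability nat R}) : measurable (f @^-1` (~` Q)).
  rewrite -[X in measurable X]setTI.
  by apply: (measurable_funPT f) => //; exact: measurableC.
exists (Kn n @^-1` (~` Q)); split=> //.
transitivity (P (K @^-1` (~` Q))); first exact: (KnK.1 n _ (measurableC mQ)).
have [N [mN N0 QN]] := QK.
by apply: (subset_measure0 (mKQ K) mN _ N0) => w /= h; exact: QN.
Qed.

Let mphi : measurable_fun setT phi.
Proof. by apply: measurableT_comp => //; exact: measurable_gf'. Qed.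

Let meta : measurable_fun setT (@half_eta R).
Proof. exact: measurable_half_eta. Qed.

Let meta_phi : measurable_fun setT (fun e => half_eta e * expR (phi e)).
Proof. by apply: measurable_funM => //; exact: measurableT_comp. Qed.

Let mperp (f g : pprobability nat R -> R) j c : measurable_fun setT f ->
  measurable_fun setT g -> <<s all_boxes >> [set y | perpetuity f g y j <= c].
Proof.
move=> mf mg; apply: (@measurable_le_cst _ _ seqE).
by apply: measurable_perpetuity => // i _; exact: all_measurable_coordinate.
Qed.

Lemma P_bsum_shift a j c :
  P [set w | bsum (env w \o addn a) j <= c] =
  P [set w | perpetuity (fun e => - phi e) half_eta (env w) j <= c].
Proof.
have := iid_reindex KnK (s := addn a)
  (C := [set y | perpetuity (fun e => - phi e) half_eta y j <= c]) (@addnI a).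
move=> <-; last by apply: mperp => //; exact: measurable_funN.
by congr (P _); apply/seteqP; split=> w /=; rewrite bsum_perpetuity.
Qed.

Lemma P_walk_bsum_shift a j c :
  P [set w | expR (walk (env w \o addn a) j) * bsum (env w \o addn a) j <= c] =
  P [set w | perpetuity phi (fun e => half_eta e * expR (phi e)) (env w) j <= c].
Proof.
have inj : injective (addn a \o rev_first j).
  by apply: inj_comp; [exact: addnI|exact: rev_first_inj].
have := iid_reindex KnK (s := addn a \o rev_first j) (C := [set y |
  perpetuity phi (fun e => half_eta e * expR (phi e)) y j <= c]) inj.
move=> <-; last exact: mperp.
by congr (P _); apply/seteqP; split=> w /=; rewrite expR_walk_bsum.
Qed.

Hypothesis env_regular : {ae P, forall w, forall n,
  fractional_linear (env w n) /\ 0 < gf' (env w n) 1}.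
Variable rho : R.
Hypothesis rho01 : 0 < rho < 1.
Hypothesis Prho : P [set w | 0 < walk (env w) n] @[n --> \oo] --> rho%:E.

Let mwalk n : measurable_fun setT (fun w => walk (env w) n).
Proof. by apply: measurable_walk => i. Qed.

Let P_psi_gt0 (psi : pprobability nat R -> R) : measurable_fun setT psi ->
  (forall e, 0 < half_eta e -> 0 < psi e) ->
  (0 < P [set w | (0 < psi (K w))%R])%E.
Proof.
move=> mpsi h.
have mQ : measurable [set e | 0 < psi e] by exact: measurable_cst_lt.
have -> : P [set w | 0 < psi (K w)] = P [set w | 0 < psi (Kn 0%N w)].
  by apply/esym; exact: (KnK.1 0%N _ mQ).
have [N [mN N0 QN]] := env_regular.
apply: (@lt_le_trans _ _ (P (~` N))); first by rewrite probability_setC// N0 sube0.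
rewrite le_measure ?inE//; first exact: measurableC.
  by apply: measurable_cst_lt; exact: measurableT_comp.
move=> w Nw; apply: h; apply: contrapT => h; apply: Nw; apply: QN => /= /(_ 0%N)[FL g0].
by apply: h; have [] := fractional_linear_affine FL g0.
Qed.

Let P_walk_gt0 : \forall n \near \oo,
  ((rho / 2)%:E <= P [set w | (0 < walk (env w) n)%R] /\
   P [set w | (0 < walk (env w) n)%R] <= ((1 + rho) / 2)%:E)%E.
Proof.
have /andP[r0 r1] := rho01.
have /fine_cvgP[fin /cvgrPdist_le h] := Prho.
near=> n.
have an : P [set w | 0 < walk (env w) n] \is a fin_num by near: n.
rewrite -(fineK an) !lee_fin.
have h1 : `|rho - fine (P [set w | 0 < walk (env w) n])| <= rho / 2.
  by near: n; apply: h; lra.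
have h2 : `|rho - fine (P [set w | 0 < walk (env w) n])| <= (1 - rho) / 2.
  by near: n; apply: h; lra.
by move: h1 h2; rewrite !ler_norml => /andP[? ?] /andP[? ?]; split; lra.
Unshelve. all: by end_near.
Qed.

(** The walk [-S] is nonnegative at time [n] with probability close to
    [1 - rho]. *)
Lemma bsum_cvg_infty c :
  P [set w | perpetuity (fun e => - phi e) half_eta (env w) n <= c]
    @[n --> \oo] --> 0%E.
Proof.
have /andP[r0 r1] := rho01.
have mN : measurable_fun setT (fun e => - phi e) by exact: measurable_funN.
apply: (perpetuity_cvg_infty KnK mN meta _ _ (c := (1 - rho) / 2)).
- exact: half_eta_ge0.
- exact: P_psi_gt0.
- lra.
near=> n.
have [_ h] : ((rho / 2)%:E <= P [set w | (0 < walk (env w) n)%R] /\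
   P [set w | (0 < walk (env w) n)%R] <= ((1 + rho) / 2)%:E)%E.
  by near: n; exact: P_walk_gt0.
rewrite (_ : [set w | _] = ~` [set w | 0 < walk (env w) n]); last first.
  apply/seteqP; split=> w /=; rewrite psumN -walk_psum oppr_ge0.
    by move=> h'; apply/negP; rewrite -leNgt.
  by move=> /negP; rewrite -leNgt.
have mw : measurable [set w | 0 < walk (env w) n] by exact: measurable_cst_lt.
rewrite probability_setC// leeBrDr ?fin_num_measure//.
apply: (le_trans (leeD (lexx _) h)); rewrite -EFinD lee_fin; lra.
Unshelve. all: by end_near.
Qed.

(** The walk [S] is positive at time [n] with probability close to [rho]. *)
Lemma walk_bsum_cvg_infty c :
  P [set w | perpetuity phi (fun e => half_eta e * expR (phi e)) (env w) n <= c]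
    @[n --> \oo] --> 0%E.
Proof.
have /andP[r0 r1] := rho01.
apply: (perpetuity_cvg_infty KnK mphi meta_phi _ _ (c := rho / 2)).
- by move=> e; rewrite mulr_ge0 ?half_eta_ge0 ?expR_ge0.
- by apply: (P_psi_gt0 meta_phi) => e h; rewrite mulr_gt0 ?expR_gt0.
- lra.
near=> n.
have [h _] : ((rho / 2)%:E <= P [set w | (0 < walk (env w) n)%R] /\
   P [set w | (0 < walk (env w) n)%R] <= ((1 + rho) / 2)%:E)%E.
  by near: n; exact: P_walk_gt0.
apply: (le_trans h); rewrite le_measure ?inE//.
- exact: (measurable_cst_lt 0 (mwalk n)).
- exact: (measurable_cst_le 0 (mwalk n)).
- by move=> w /= /ltW.
Unshelve. all: by end_near.
Qed.

Lemma odds_tight c : 0 < c ->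
  P [set w | M%:R * c < extinction_odds (K w)] @[M --> \oo] --> 0%E.
Proof.
move=> c0.
have mo : measurable_fun setT (fun w => extinction_odds (K w)).
  exact: measurable_extinction_odds.
have mA M : measurable [set w | M%:R * c < extinction_odds (K w)].
  exact: measurable_cst_lt.
rewrite -(measure0 P).
rewrite (_ : set0 = \bigcap_M [set w | M%:R * c < extinction_odds (K w)]).
  apply: nonincreasing_cvg_mu => //.
  - by rewrite ltey_eq fin_num_measure.
  - exact: bigcapT_measurable.
  - move=> i j ij; apply/subsetPset => w /=; apply: le_lt_trans.
    by rewrite ler_wpM2r ?ler_nat// ltW.
apply/seteqP; split=> // w /(_ (Num.truncn (extinction_odds (K w) / c)).+1 Logic.I)/=.
by apply/negP; rewrite -leNgt -ler_pdivrMr// ltW// truncnS_gt.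
Qed.

Lemma P_odds n c : P [set w | c < extinction_odds (env w n)] =
  P [set w | c < extinction_odds (K w)].
Proof.
apply: (KnK.1 n [set e | c < extinction_odds e]).
apply: measurable_cst_lt; exact: measurable_extinction_odds.
Qed.

End IIDEnvironment.

(* [Pk w] is the law P_k given the environment [fun n => Kn n w], carried by a
   space [W] on which Z is defined. The case [W = Omega] with [Pk] a regular
   conditional probability given the environment is included. *)
Theorem theorem2 (R : realType) (d d' : measure_display)
    (Omega : measurableType d) (W : measurableType d')
    (P : probability Omega R)
    (K : {mfun Omega >-> pprobability nat R})
    (Kn : nat -> {mfun Omega >-> pprobability nat R})
    (Pk : R.-pker Omega ~> W) (Z : nat -> {mfun W >-> nat})
    (rho eps0 : R) (a : nat) :
  let env (w : Omega) (n : nat) : pprobability nat R := Kn n w in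
  let S (w : Omega) : nat -> R := walk (env w) in
  let X (w : Omega) : R := log_mean (K w) in
  let L (w : Omega) : \bar R := log_plus (Theta a (K w)) in
  iid_copies P K Kn ->
  {ae P, forall w, (0 < mean (K w) < +oo)%E} ->
  {ae P, forall w, branching_process (Pk w) (env w) Z} ->
  (* the conditioning on T = n makes sense *)
  {ae P, forall w, forall n, (0 < n)%N -> (0 < Pk w (extinct_at Z n))%E} ->
  0 < rho < 1 ->
  P [set w | 0 < S w n] @[n --> \oo] --> rho%:E ->
  0 < eps0 ->
  (\int[P]_w poweR (L w) (rho^-1 + eps0)%R < +oo)%E ->
  (\int[P]_w (renewalV P S (X w) * poweR (L w) (1 + eps0)%R) < +oo)%E ->
  (\int[P]_w poweR (L w) ((1 - rho)^-1 + eps0)%R < +oo)%E ->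
  (\int[P]_w (renewalU P S (- X w)%R * poweR (L w) (1 + eps0)%R) < +oo)%E ->
  {ae P, forall w, forall n, fractional_linear (env w n)} ->
  forall t lambda : R, 0 < t < 1 -> 0 < lambda ->
  cvg_in_probability P
    (fun n w =>
       let m := Num.truncn (n%:R * t) in
       cond_expectation (Pk w)
         (fun x => expR (- (lambda * ((Z m x)%:R / Onorm (env w) m n))))
         (extinct_at Z n))
    ((1 + lambda) ^- 2).
Proof.
move=> env S X L KnK meanK muZ ext rho01 Prho _ _ _ _ _ FL t lambda t01 l0.
have gfK : {ae P, forall w, 0 < gf' (K w) 1}.
  by apply: filterS meanK => w h; rewrite gf'_mean fine_gt0.
have mpos : measurable [set e : pprobability nat R | 0 < gf' e 1].
  by apply: measurable_cst_lt; exact: measurable_gf'.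
have pos := iid_ae KnK mpos gfK.
have reg : {ae P, forall w, forall n,
    fractional_linear (env w n) /\ 0 < gf' (env w n) 1}.
  by apply: filterS2 FL pos => w h1 h2 n; split; [exact: h1|exact: h2].
have [N [mN N0 GN]] : {ae P, forall w, [/\ (forall n,
    fractional_linear (env w n) /\ 0 < gf' (env w n) 1),
    branching_process (Pk w) (env w) Z &
    forall n, (0 < n)%N -> (0 < Pk w (extinct_at Z n))%E]}.
  by apply: filterS3 reg muZ ext => w h1 h2 h3; split.
have mEnv i : measurable_fun setT (fun w => env w i) by [].
move=> e e0.
pose Y (n : nat) (w : Omega) : R := let m := Num.truncn (n%:R * t) in
  cond_expectation (Pk w)
    (fun x => expR (- (lambda * ((Z m x)%:R / Onorm (env w) m n))))
    (extinct_at Z n).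
suff : P [set w | e < `|Y n w - (1 + lambda) ^- 2|] @[n --> \oo] --> 0%E by [].
have mZ n : measurable_fun setT (Z n : W -> nat) by [].
have mY n : measurable_fun setT (Y n).
  apply: (measurable_cond_expectation Pk (Z := Z (Num.truncn (n%:R * t)))
    (g := fun w z => expR (- (lambda * (z%:R /
       Onorm (env w) (Num.truncn (n%:R * t)) n))))).
  - exact: measurable_extinct_at.
  - exact: mZ.
  - move=> z; apply: measurableT_comp => //; apply: measurableT_comp => //.
    apply: measurable_funM => //; apply: measurable_funM => //.
    by apply: measurable_inv; exact: measurable_Onorm.
  - by move=> w z; exact: expR_ge0.
have mBad n : measurable [set w | e < `|Y n w - (1 + lambda) ^- 2|].
  apply: measurable_cst_lt; apply: measurableT_comp => //.
  exact: measurable_funB.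
(* [C * del] is the bound of [quenched_estimate]. *)
pose C := 4 * (lambda + 2 * lambda ^+ 2) + 3 * lambda.
have C0 : 0 < C by rewrite !addr_gt0 ?mulr_gt0 ?addr_gt0 ?mulr_gt0 ?exprn_gt0.
pose del := Num.min 2^-1 (e / C).
have del0 : 0 < del by rewrite lt_min invr_gt0 ltr0n divr_gt0.
have del2 : del <= 2^-1 by rewrite ge_min lexx.
have delC : C * del <= e by rewrite mulrC -ler_pdivlMr// ge_min lexx orbT.
apply: near_le_cvge0 => [n|eps eps_gt0]; first exact: measure_ge0.
have eps4 : 0 < eps / 4 by rewrite divr_gt0.
(* The level [M] is chosen before [n], as the odds are identically distributed. *)
have [M0 _ /(_ M0.+1 (leqnSn _)) hM] :=
  cvge0_near_le (odds_tight P K del0) eps4.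
set M : R := M0.+1%:R in hM.
have M_gt0 : 0 < M by rewrite ltr0Sn.
have [N1 _ h1] := cvge0_near_le
  (walk_bsum_cvg_infty KnK reg rho01 Prho del^-1) eps4.
have [N2 _ h2] := cvge0_near_le
  (bsum_cvg_infty KnK reg rho01 Prho del^-1) eps4.
have [N3 _ h3] := cvge0_near_le
  (walk_bsum_cvg_infty KnK reg rho01 Prho M) eps4.
near=> n.
have [l /= [Nm Nl nE]] : exists l, let m := Num.truncn (n%:R * t) in
    [/\ (maxn N1 (maxn N2 N3) < m)%N, (maxn N1 (maxn N2 N3) < l)%N &
        n = (m + l).+1].
  by near: n; exact: near_split_time.
set m := Num.truncn (n%:R * t) in Nm nE.
have m0 : (0 < m)%N by exact: leq_ltn_trans Nm.
have ll0 : (0 < l)%N by exact: leq_ltn_trans Nl.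
pose Q i j w := expR (walk (env w \o addn i) j) * bsum (env w \o addn i) j.
have mQ i j : measurable_fun setT (Q i j).
  apply: measurable_funM; last exact: measurable_bsum.
  by apply: measurableT_comp => //; exact: measurable_walk.
(* Outside these four events and a null set, [quenched_estimate] applies: [E1]
   and [E2] bound its first two quantities, [E3] and [E4] the third one. *)
pose E1 := [set w | Q 0%N m w <= del^-1].
pose E2 := [set w | bsum (env w \o addn m) l <= del^-1].
pose E3 := [set w | Q m l w <= M].
pose E4 := [set w | M * del < extinction_odds (env w (m + l)%N)].
have mE1 : measurable E1 by exact: measurable_le_cst.
have mE2 : measurable E2 by apply: measurable_le_cst; exact: measurable_bsum.
have mE3 : measurable E3 by exact: measurable_le_cst.
have mE4 : measurable E4.
  by apply: measurable_cst_lt; exact: measurable_extinction_odds.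
have PE1 : (P E1 <= (eps / 4)%:E)%E.
  rewrite /E1 /Q (P_walk_bsum_shift KnK); apply: h1 => /=.
  by apply: ltnW; apply: leq_ltn_trans Nm; rewrite leq_maxl.
have PE2 : (P E2 <= (eps / 4)%:E)%E.
  rewrite /E2 (P_bsum_shift KnK); apply: h2 => /=.
  by apply: ltnW; apply: leq_ltn_trans Nl; rewrite !leq_max leqnn orbT.
have PE3 : (P E3 <= (eps / 4)%:E)%E.
  rewrite /E3 /Q (P_walk_bsum_shift KnK); apply: h3 => /=.
  by apply: ltnW; apply: leq_ltn_trans Nl; rewrite !leq_max leqnn !orbT.
have PE4 : (P E4 <= (eps / 4)%:E)%E by rewrite /E4 (P_odds KnK).
pose F := (E1 `|` E2) `|` (E3 `|` E4) `|` N.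
have mF : measurable F by do 3 apply: measurableU => //; exact: measurableU.
apply: (@le_trans _ _ (P F)).
  rewrite le_measure ?inE// => w /= bad; apply: contrapT => wF.
  have nE1 : ~ E1 w by move=> ?; apply: wF; left; left; left.
  have nE2 : ~ E2 w by move=> ?; apply: wF; left; left; right.
  have nE3 : ~ E3 w by move=> ?; apply: wF; left; right; left.
  have nE4 : ~ E4 w by move=> ?; apply: wF; left; right; right.
  have [regw muZw extw] : [/\ (forall n, fractional_linear (env w n) /\
      0 < gf' (env w n) 1), branching_process (Pk w) (env w) Z &
      forall n, (0 < n)%N -> (0 < Pk w (extinct_at Z n))%E].
    by apply: contrapT => h; apply: wF; right; exact: GN.
  have dV : 0 < del^-1 by rewrite invr_gt0.
  move: nE1 nE2 nE3 nE4 => /negP; rewrite -ltNge => lt1 /negP.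
  rewrite -ltNge => lt2 /negP; rewrite -ltNge => lt3 /negP; rewrite -leNgt => le4.
  have := quenched_estimate mZ (prob_kernel w) muZw (fun i => (regw i).1)
    (fun i => (regw i).2) extw l0 m0 ll0 del2.
  rewrite -nE => est; move: bad; apply/negP; rewrite -leNgt.
  apply: le_trans delC; apply: est.
  - rewrite -[leRHS]invrK lef_pV2 ?posrE//; first exact: ltW lt1.
    exact: lt_trans lt1.
  - rewrite -[leRHS]invrK lef_pV2 ?posrE//; first exact: ltW lt2.
    exact: lt_trans lt2.
  - rewrite ler_pdivrMr; last exact: lt_trans lt3.
    by apply: (le_trans le4); rewrite mulrC ler_wpM2l ?ltW.
apply: (le_trans (measureU2 _ _ _)) => //.
  by do 2 apply: measurableU => //; exact: measurableU.
rewrite [X in (_ + X)%E](_ : _ = 0%E)// adde0.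
apply: (le_trans (measureU2 _ _ _)); [exact: measurableU..|].
apply: (le_trans (leeD (measureU2 _ mE1 mE2) (measureU2 _ mE3 mE4))).
apply: (le_trans (leeD (leeD PE1 PE2) (leeD PE3 PE4))).
by rewrite -!EFinD lee_fin; lra.
Unshelve. all: by end_near.
Qed.
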